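(* Let $D$ and $D'$ be diagrams representing the same oriented classical or virtual knot or link, let $X$ be a finite mc-biquandle, and let $S\subset\mathrm{End}(X)$. Then the in-degree polynomials agree: $$\Phi_X^{S,\mathrm{deg}^+}(D)=\Phi_X^{S,\mathrm{deg}^+}(D').$$
   Context: **mc-biquandles.** An mc-biquandle is a set $X$ with two pairs of binary operations $\underline{\triangleright}^s,\overline{\triangleright}^s$ and $\underline{\triangleright}^m,\overline{\triangleright}^m$ such that: (i) for all $x\in X$, $x\,\overline{\triangleright}^s x=x\,\underline{\triangleright}^s x$; (ii) for all $y\in X$ and $j\in\{s,m\}$, the maps $\alpha^j_y,\beta^j_y:X\to X$, $\alpha^j_y(x)=x\,\underline{\triangleright}^j y$, $\beta^j_y(x)=x\,\overline{\triangleright}^j y$, are invertible, and the map $S^j:X\times X\to X\times X$, $S^j(x,y)=(y\,\overline{\triangleright}^j x,\;x\,\underline{\triangleright}^j y)$, is invertible; (iii) for all $x,y,z\in X$ and all $(j,k,l)\in\{(s,s,s),(s,m,m),(m,s,m),(m,m,s),(m,m,m)\}$: $$(x\,\overline{\triangleright}^k y)\,\overline{\triangleright}^l (z\,\overline{\triangleright}^j y)=(x\,\overline{\triangleright}^l z)\,\overline{\triangleright}^k (y\,\underline{\triangleright}^j z),$$ $$(x\,\underline{\triangleright}^l y)\,\overline{\triangleright}^j (z\,\underline{\triangleright}^k y)=(x\,\overline{\triangleright}^j z)\,\underline{\triangleright}^l (y\,\overline{\triangleright}^k z),$$ $$(x\,\underline{\triangleright}^k y)\,\underline{\triangleright}^j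 (z\,\underline{\triangleright}^l y)=(x\,\underline{\triangleright}^j z)\,\underline{\triangleright}^k (y\,\overline{\triangleright}^l z).$$ A homomorphism of mc-biquandles is a map preserving all four operations; $\mathrm{Hom}(Y,X)$ is the set of homomorphisms $Y\to X$, and $\mathrm{End}(X)=\mathrm{Hom}(X,X)$. **Diagrams.** Two diagrams of oriented classical links represent the same link iff they are related by planar isotopy and oriented Reidemeister moves I, II, III; for virtual link diagrams one also allows the virtual moves (detour moves). A classical (non-virtual) crossing is single-component (type $s$) if both its strands belong to the same component of the link, and multi-component (type $m$) if they belong to different components. Semiarcs are the pieces obtained by cutting the diagram at all classical crossing points, on both the over- and the understrand (virtual crossings do not cut; a component with no classical crossing contributes one semiarc). **Crossing relations.** At a classical crossing of type $l\in\{s,m\}$, let $x$ be the semiarc of the understrand lying to the right of the oriented overstrand, $y$ the semiarc of the overstrand lying to the right of the oriented understrand, $x'$ the other understrand semiarc and $y'$ the other overstrand semiarc. The crossing relations are $x'=x\,\underline{\triangleright}^l y$ and $y'=y\,\overline{\triangleright}^l x$. (For a positive crossing $x$ is the incoming under-semiarc and $y$ the outgoing over-semiarc; for a negative crossing $x$ is the outgoing under-semiarc and $y$ the incoming over-semiarc.) Nothing is imposed at virtual crossings. **Fundamental mc-biquandle.** For a diagram $D$, $\mathcal{MCB}(D)$ is defined as follows. Take one generator for each semiarc of $D$. An mc-biquandle word is a generator or an expression of one of the forms $w\,\underline{\triangleright}^l w'$, $w\,\overline{\triangleright}^l w'$, $(\alpha^l_{w})^{-1}(w')$, $(\beta^l_{w})^{-1}(w')$,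 $(S^l)^{-1}_i(w,w')$, where $l\in\{s,m\}$, $i\in\{1,2\}$, $w,w'$ are mc-biquandle words, and $(S^l)^{-1}_i$ denotes the $i$-th component of $(S^l)^{-1}$. The elements of $\mathcal{MCB}(D)$ are the equivalence classes of mc-biquandle words under the congruence generated by the mc-biquandle axioms and the crossing relations at all classical crossings of $D$. Elements of $\mathrm{Hom}(\mathcal{MCB}(D),X)$ correspond to $X$-colorings of $D$, i.e. assignments of elements of $X$ to the semiarcs satisfying all crossing relations. **Coloring quiver and in-degree polynomial.** For a diagram $D$ and $S\subset\mathrm{End}(X)$, the mc-biquandle coloring quiver $\mathcal{Q}_X^S(D)$ is the directed graph (loops and parallel edges allowed) with one vertex for each $f\in\mathrm{Hom}(\mathcal{MCB}(D),X)$ and, for each vertex $f$ and each $\phi\in S$, one edge from $f$ to the vertex obtained by applying $f$ first and then $\phi$, i.e. $\phi\circ f$. The in-degree polynomial is $$\Phi_X^{S,\mathrm{deg}^+}(D)=\sum_{f\in\mathrm{Hom}(\mathcal{MCB}(D),X)}u^{\mathrm{deg}_+(f)},$$ where $u$ is a formal variable and $\mathrm{deg}_+(f)$ is the in-degree (number of incoming edges, counted with multiplicity, loops included) of the vertex $f$ in $\mathcal{Q}_X^S(D)$. *)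

(* Defs.v *)
From HB Require Import structures.
From mathcomp Require Import all_boot all_order all_algebra all_fingroup finmap.
From mathcomp Require Import boolp classical_sets functions cardinality fsbigop.
From Stdlib Require Import Relation_Operators.

Set Implicit Arguments.
Unset Strict Implicit.
Unset Printing Implicit Defensive.

Import GRing.Theory.

Local Open Scope classical_set_scope.
Local Open Scope ring_scope.

Variant crossing_type := Single | Multi.

Definition admissible (j k l : crossing_type) : Prop :=
  match j, k, l with
  | Single, Single, Single | Single, Multi, Multi | Multi, Single, Multi
  | Multi, Multi, Single | Multi, Multi, Multi => True
  | _, _, _ => False
  end.

(* [und l x y] and [ovr l x y] are the underlined and the overlined           *)
(* operations of type l, applied to x (acted upon) and y (acting).            *)
HB.mixin Record isMCBiquandle (T : Type) := {
  und : crossing_type -> T -> T -> T;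
  ovr : crossing_type -> T -> T -> T;
  ovr_diag : forall x, ovr Single x x = und Single x x;
  und_bij : forall l y, bijective (fun x => und l x y);
  ovr_bij : forall l y, bijective (fun x => ovr l x y);
  switch_bij : forall l,
    bijective (fun p : T * T => (ovr l p.2 p.1, und l p.1 p.2));
  ovr_ovr : forall j k l, admissible j k l -> forall x y z,
    ovr l (ovr k x y) (ovr j z y) = ovr k (ovr l x z) (und j y z);
  und_ovr : forall j k l, admissible j k l -> forall x y z,
    ovr j (und l x y) (und k z y) = und l (ovr j x z) (ovr k y z);
  und_und : forall j k l, admissible j k l -> forall x y z,
    und j (und k x y) (und l z y) = und k (und j x z) (ovr l y z)
}.

#[short(type="mcBiquandleType")]
HB.structure Definition MCBiquandle := { T of isMCBiquandle T }.

#[short(type="finMCBiquandleType")]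
HB.structure Definition FinMCBiquandle := { T of isMCBiquandle T & Finite T }.

Definition Hom (Y X : mcBiquandleType) : set (Y -> X) :=
  [set f | forall l x y, f (und l x y) = und l (f x) (f y)
                      /\ f (ovr l x y) = ovr l (f x) (f y)].
Arguments Hom Y X : clear implicits.

Definition End (X : mcBiquandleType) : set (X -> X) := Hom X X.
Arguments End X : clear implicits.

(* A link diagram is encoded by its crossings, classical and virtual, and the *)
(* way its oriented strands run through them.  Each crossing c is visited     *)
(* twice: (c, true) and (c, false) are the passages along its over- and its   *)
(* understrand; at a virtual crossing the two names are arbitrary.  [succ v]  *)
(* is the passage that follows v along its component.  [positive c] means     *)
(* that the pair of directions (true strand, false strand) is a positive      *)
(* frame of the plane; this is the usual sign of a classical crossing.        *)
(* A component without any crossing is a [component] that no passage is on.   *)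
Record code := Code {
  crossing : finType;
  component : finType;
  virtual : pred crossing;
  positive : pred crossing;
  succ : {perm crossing * bool};
  component_of : crossing * bool -> component;
  component_ofP : forall u v,
    (component_of u == component_of v) = (v \in porbit succ u)
}.

Definition passage (D : code) : finType := (crossing D * bool)%type.

(* A half-edge is a passage together with an end of it: true for the end      *)
(* leaving the crossing, false for the end entering it.                       *)
Definition half_edge (D : code) : finType := (passage D * bool)%type.

Definition other_half (D : code) (h : half_edge D) : half_edge D :=
  if h.2 then (succ D h.1, false) else (((succ D)^-1)%g h.1, true).

(* The counterclockwise neighbour of h at its crossing.  The cyclic order is  *)
(* (true, in), (false, in), (true, out), (false, out) at a positive crossing, *)
(* and (true, in), (false, out), (true, out), (false, in) at a negative one.  *)
Definition rotate (D : code) (h : half_edge D) : half_edge D :=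
  let: ((c, b), o) := h in ((c, ~~ b), o (+) (b (+) positive c)).

Definition next_on_face (D : code) (h : half_edge D) : half_edge D :=
  rotate (other_half h).

Definition adjacent (D : code) : rel (crossing D) := fun c d =>
  [exists b, exists b', (succ D (c, b) == (d, b')) || (succ D (d, b') == (c, b))].

(* Euler's formula V - E + F = 2 C for the 4-valent graph of D, where E = 2 V *)
(* and C is the number of its connected pieces.                               *)
Definition planar (D : code) : bool :=
  fcard (@next_on_face D) predT
    == (#|crossing D| + 2 * n_comp (@adjacent D) predT)%N.

(* A virtual link diagram up to planar isotopy (and up to the position of its *)
(* connected pieces relative to each other, which is immaterial to the link   *)
(* and to the semiarcs).  It is classical when no crossing is virtual.        *)
Record diagram := Diagram { code_of :> code; diagram_planar : planar code_of }.

Section Semiarcs.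
Variable D : code.

(* The edges of D: the one that leaves a given passage, or a whole component  *)
(* without crossing.                                                          *)
Definition edge : finType :=
  (passage D + {k : component D | [forall v, component_of v != k]})%type.

Definition edge_out (v : passage D) : edge := inl v.
Definition edge_in (v : passage D) : edge := inl (((succ D)^-1)%g v).

Definition glued : rel edge := fun e e' =>
  [exists v : passage D, virtual v.1 &&
    (((e == edge_in v) && (e' == edge_out v))
     || ((e == edge_out v) && (e' == edge_in v)))].

(* The edges that make up the semiarc of e: virtual crossings do not cut.     *)
Definition edges_of (e : edge) : {set edge} := [set e' | connect glued e e']%SET.

Definition semiarc : finType :=
  {A : {set edge} | A \in [set edges_of e | e : edge]%SET}.

Fact edges_of_semiarc (e : edge) :
  edges_of e \in [set edges_of e' | e' : edge]%SET.
Proof. exact: imset_f. Qed.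

Definition semiarc_of (e : edge) : semiarc :=
  exist _ (edges_of e) (edges_of_semiarc e).

Definition type_of (c : crossing D) : crossing_type :=
  if component_of (c, true) == component_of (c, false) then Single else Multi.

(* The semiarcs at a classical crossing that lie to the right or to the left  *)
(* of the other strand.                                                       *)
Definition under_right (c : crossing D) : semiarc :=
  semiarc_of (if positive c then edge_in (c, false) else edge_out (c, false)).
Definition under_left (c : crossing D) : semiarc :=
  semiarc_of (if positive c then edge_out (c, false) else edge_in (c, false)).
Definition over_right (c : crossing D) : semiarc :=
  semiarc_of (if positive c then edge_out (c, true) else edge_in (c, true)).
Definition over_left (c : crossing D) : semiarc :=
  semiarc_of (if positive c then edge_in (c, true) else edge_out (c, true)).

End Semiarcs.

Section Moves.
Variable D : code.

(* The first passage after v at a crossing outside K; it is meant for v       *)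
(* itself outside K.                                                          *)
Definition succ_outside (K : {set crossing D}) (v : passage D) : passage D :=
  let s := traject (succ D) (succ D v) #|passage D| in
  nth v s (find (fun u : passage D => u.1 \notin K) s).

(* D' is, up to names, the code whose crossings are those of D outside K,     *)
(* where v is followed by [nx v] and passages stay on their components.  The  *)
(* names true and false may be exchanged at the virtual crossings where [sw]  *)
(* holds, which reverses the sign.                                            *)
Definition presents (K : {set crossing D}) (nx : passage D -> passage D)
    (D' : code) : Prop :=
  exists (f : crossing D' -> crossing D) (sw : pred (crossing D'))
         (g : component D' -> component D),
    let F (v : passage D') : passage D := (f v.1, v.2 (+) sw v.1) in
    [/\ injective f /\ (forall c, (c \notin K) = (c \in codom f)),
        bijective g,
        forall c, [/\ virtual c = virtual (f c),
                      positive c = positive (f c) (+) sw c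
                    & sw c -> virtual c],
        forall v, g (component_of v) = component_of (F v)
      & forall v, F (succ D' v) = nx (F v)].

Definition erases (K : {set crossing D}) (D' : code) : Prop :=
  presents K (succ_outside K) D'.

(* v comes right before w if t holds, right after w otherwise.                *)
Definition neighbours (t : bool) (v w : passage D) : Prop :=
  if t then succ D v = w else succ D w = v.

(* Planar isotopy and the oriented Reidemeister moves, classical and virtual. *)
(* - [move_I]: D' is D without a kink, classical or virtual.                  *)
(* - [move_II]: D' is D without a bigon formed by the true strand and the     *)
(*   false strand of c and d, both classical or both virtual.                 *)
(* - [move_III]: three strands, top (true at a and b), middle (false at a,    *)
(*   true at c) and bottom (false at b and c), form a triangle, and in D' each *)
(*   of them meets the other two in the opposite order.  The crossings are    *)
(*   all classical, all virtual, or c is the only classical one.  The two     *)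
(*   equations between signs say that the three edges do bound a triangle:    *)
(*   each side is the orientation of the triangle abc in the plane.           *)
(* As names are exchangeable at virtual crossings, these cover all virtual    *)
(* moves, including the mixed one; together they generate detour moves.       *)
Variant move (D' : code) : Prop :=
| isotopy of presents finset.set0 (succ D) D'
| move_I (c : crossing D) (b : bool) of
    succ D (c, b) = (c, ~~ b) &
    erases [set c]%SET D'
| move_II (c d : crossing D) (t : bool) of
    virtual c = virtual d &
    positive c = ~~ positive d &
    succ D (c, true) = (d, true) &
    neighbours t (c, false) (d, false) &
    erases [set c; d]%SET D'
| move_III (a b c : crossing D) (t m n : bool) of
    uniq [:: a; b; c] &
    virtual a = virtual b /\ (virtual c -> virtual a) &
    neighbours t (a, true) (b, true) &
    neighbours m (a, false) (c, true) &
    neighbours n (b, false) (c, false) &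
    positive a (+) t (+) m = positive b (+) t (+) n &
    positive b (+) t (+) n = positive c (+) m (+) n &
    presents finset.set0
      (succ D ^ (tperm (a, true) (b, true) * tperm (a, false) (c, true)
                 * tperm (b, false) (c, false)))%g D'.

End Moves.

(* On classical diagrams, the equivalence generated by the classical moves    *)
(* among classical diagrams is contained in this one.                         *)
Definition same_link : diagram -> diagram -> Prop :=
  clos_refl_sym_trans diagram (fun D D' => move D D').

Inductive word (G : Type) : Type :=
| Gen of G
| Und of crossing_type & word G & word G
| Ovr of crossing_type & word G & word G
| UndInv of crossing_type & word G & word G
| OvrInv of crossing_type & word G & word G
| SwitchInv1 of crossing_type & word G & word G
| SwitchInv2 of crossing_type & word G & word G.
Arguments Gen {G}.

HB.instance Definition _ (G : Type) := gen_eqMixin (word G).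
HB.instance Definition _ (G : Type) := gen_choiceMixin (word G).

(* [UndInv l w w'] and [OvrInv l w w'] are the inverses of the right actions  *)
(* of w, applied to w'; [SwitchInv1] and [SwitchInv2] are the components of   *)
(* the inverse of (x, y) |-> (ovr l y x, und l x y).                          *)
Inductive congruent (D : code) : word (semiarc D) -> word (semiarc D) -> Prop :=
| cg_refl w : congruent w w
| cg_sym w w' : congruent w w' -> congruent w' w
| cg_trans w w' w'' : congruent w w' -> congruent w' w'' -> congruent w w''
| cg_und l v v' w w' : congruent v v' -> congruent w w' ->
    congruent (Und l v w) (Und l v' w')
| cg_ovr l v v' w w' : congruent v v' -> congruent w w' ->
    congruent (Ovr l v w) (Ovr l v' w')
| cg_undinv l v v' w w' : congruent v v' -> congruent w w' ->
    congruent (UndInv l v w) (UndInv l v' w')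
| cg_ovrinv l v v' w w' : congruent v v' -> congruent w w' ->
    congruent (OvrInv l v w) (OvrInv l v' w')
| cg_switchinv1 l v v' w w' : congruent v v' -> congruent w w' ->
    congruent (SwitchInv1 l v w) (SwitchInv1 l v' w')
| cg_switchinv2 l v v' w w' : congruent v v' -> congruent w w' ->
    congruent (SwitchInv2 l v w) (SwitchInv2 l v' w')
| cg_diag x : congruent (Ovr Single x x) (Und Single x x)
| cg_undK l x y : congruent (UndInv l y (Und l x y)) x
| cg_undKV l x y : congruent (Und l (UndInv l y x) y) x
| cg_ovrK l x y : congruent (OvrInv l y (Ovr l x y)) x
| cg_ovrKV l x y : congruent (Ovr l (OvrInv l y x) y) x
| cg_switchK1 l x y : congruent (SwitchInv1 l (Ovr l y x) (Und l x y)) x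
| cg_switchK2 l x y : congruent (SwitchInv2 l (Ovr l y x) (Und l x y)) y
| cg_switchKV1 l x y :
    congruent (Ovr l (SwitchInv2 l x y) (SwitchInv1 l x y)) x
| cg_switchKV2 l x y :
    congruent (Und l (SwitchInv1 l x y) (SwitchInv2 l x y)) y
| cg_ovr_ovr j k l x y z : admissible j k l ->
    congruent (Ovr l (Ovr k x y) (Ovr j z y)) (Ovr k (Ovr l x z) (Und j y z))
| cg_und_ovr j k l x y z : admissible j k l ->
    congruent (Ovr j (Und l x y) (Und k z y)) (Und l (Ovr j x z) (Ovr k y z))
| cg_und_und j k l x y z : admissible j k l ->
    congruent (Und j (Und k x y) (Und l z y)) (Und k (Und j x z) (Ovr l y z))
| cg_under (c : crossing D) : ~~ virtual c ->
    congruent (Gen (under_left c))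
      (Und (type_of c) (Gen (under_right c)) (Gen (over_right c)))
| cg_over (c : crossing D) : ~~ virtual c ->
    congruent (Gen (over_left c))
      (Ovr (type_of c) (Gen (over_right c)) (Gen (under_right c))).

Section FundamentalMCBiquandle.
Variable D : code.

Definition congruentb : rel (word (semiarc D)) := fun w w' => `[< congruent w w' >].

Lemma congruentb_equiv : equiv_class_of congruentb.
Proof.
split=> [w|w w'|w v u].
- by apply/asboolP; exact: cg_refl.
- by apply/asboolP/asboolP; exact: cg_sym.
- by move=> /asboolP wv /asboolP vu; apply/asboolP; exact: cg_trans vu.
Qed.

Canonical congruentb_equivRel := EquivRelPack congruentb_equiv.

Definition MCB : Type := {eq_quot congruentb}%qT.

HB.instance Definition _ := Choice.on MCB.

Definition class (w : word (semiarc D)) : MCB := (\pi_{eq_quot congruentb} w)%qT.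
Definition rep (x : MCB) : word (semiarc D) := generic_quotient.repr (x : {eq_quot congruentb}%qT).

Lemma repK : cancel rep class. Proof. exact: reprK. Qed.

Lemma classE w w' : class w = class w' <-> congruent w w'.
Proof.
split; first by move=> /eqmodP/asboolP.
by move=> h; apply/eqmodP/asboolP.
Qed.

Lemma class_rep w : congruent (rep (class w)) w.
Proof. by apply/classE; rewrite repK. Qed.

Definition mcb_und l (x y : MCB) : MCB := class (Und l (rep x) (rep y)).
Definition mcb_ovr l (x y : MCB) : MCB := class (Ovr l (rep x) (rep y)).

Lemma mcb_undE l v w : mcb_und l (class v) (class w) = class (Und l v w).
Proof. by apply/classE; apply: cg_und; exact: class_rep. Qed.
Lemma mcb_ovrE l v w : mcb_ovr l (class v) (class w) = class (Ovr l v w).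
Proof. by apply/classE; apply: cg_ovr; exact: class_rep. Qed.

Let mcbE := (mcb_undE, mcb_ovrE).

Lemma mcb_ind (P : MCB -> Prop) : (forall w, P (class w)) -> forall x, P x.
Proof. by move=> h x; rewrite -(repK x); exact: h. Qed.

Fact mcb_ovr_diag x : mcb_ovr Single x x = mcb_und Single x x.
Proof. by elim/mcb_ind: x => x; rewrite !mcbE; apply/classE; exact: cg_diag. Qed.

Fact mcb_und_bij l y : bijective (fun x => mcb_und l x y).
Proof.
elim/mcb_ind: y => y.
exists (fun x => class (UndInv l y (rep x))); elim/mcb_ind=> x.
- rewrite mcbE; apply/classE; apply: cg_trans (cg_undK l x y).
  by apply: cg_undinv; [exact: cg_refl|exact: class_rep].
- rewrite mcbE; apply/classE; apply: cg_trans (cg_undKV l x y).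
  apply: cg_und; last exact: cg_refl.
  by apply: cg_undinv; [exact: cg_refl|exact: class_rep].
Qed.

Fact mcb_ovr_bij l y : bijective (fun x => mcb_ovr l x y).
Proof.
elim/mcb_ind: y => y.
exists (fun x => class (OvrInv l y (rep x))); elim/mcb_ind=> x.
- rewrite mcbE; apply/classE; apply: cg_trans (cg_ovrK l x y).
  by apply: cg_ovrinv; [exact: cg_refl|exact: class_rep].
- rewrite mcbE; apply/classE; apply: cg_trans (cg_ovrKV l x y).
  apply: cg_ovr; last exact: cg_refl.
  by apply: cg_ovrinv; [exact: cg_refl|exact: class_rep].
Qed.

Fact mcb_switch_bij l :
  bijective (fun p : MCB * MCB => (mcb_ovr l p.2 p.1, mcb_und l p.1 p.2)).
Proof.
exists (fun p => (class (SwitchInv1 l (rep p.1) (rep p.2)),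
                  class (SwitchInv2 l (rep p.1) (rep p.2)))).
- move=> -[x y]; elim/mcb_ind: x => x; elim/mcb_ind: y => y /=.
  rewrite !mcbE; congr pair; apply/classE.
  + apply: cg_trans (cg_switchK1 l x y).
    by apply: cg_switchinv1; exact: class_rep.
  + apply: cg_trans (cg_switchK2 l x y).
    by apply: cg_switchinv2; exact: class_rep.
- move=> -[x y] /=; rewrite !mcbE -[in RHS](repK x) -[in RHS](repK y).
  by congr pair; apply/classE; [exact: cg_switchKV1|exact: cg_switchKV2].
Qed.

Fact mcb_ovr_ovr j k l : admissible j k l -> forall x y z,
  mcb_ovr l (mcb_ovr k x y) (mcb_ovr j z y)
  = mcb_ovr k (mcb_ovr l x z) (mcb_und j y z).
Proof.
move=> jkl; elim/mcb_ind=> x; elim/mcb_ind=> y; elim/mcb_ind=> z.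
by rewrite !mcbE; apply/classE; exact: cg_ovr_ovr.
Qed.

Fact mcb_und_ovr j k l : admissible j k l -> forall x y z,
  mcb_ovr j (mcb_und l x y) (mcb_und k z y)
  = mcb_und l (mcb_ovr j x z) (mcb_ovr k y z).
Proof.
move=> jkl; elim/mcb_ind=> x; elim/mcb_ind=> y; elim/mcb_ind=> z.
by rewrite !mcbE; apply/classE; exact: cg_und_ovr.
Qed.

Fact mcb_und_und j k l : admissible j k l -> forall x y z,
  mcb_und j (mcb_und k x y) (mcb_und l z y)
  = mcb_und k (mcb_und j x z) (mcb_ovr l y z).
Proof.
move=> jkl; elim/mcb_ind=> x; elim/mcb_ind=> y; elim/mcb_ind=> z.
by rewrite !mcbE; apply/classE; exact: cg_und_und.
Qed.

HB.instance Definition _ := isMCBiquandle.Build MCB mcb_ovr_diag mcb_und_bij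
  mcb_ovr_bij mcb_switch_bij mcb_ovr_ovr mcb_und_ovr mcb_und_und.

End FundamentalMCBiquandle.

(* The vertices and arrows are the elements of the two sets; source and       *)
(* target only matter on arrows.                                              *)
Record quiver := Quiver {
  vertexT : choiceType;
  arrowT : choiceType;
  vertices : set vertexT;
  arrows : set arrowT;
  source : arrowT -> vertexT;
  target : arrowT -> vertexT
}.
Arguments vertices : clear implicits.
Arguments arrows : clear implicits.

(* The arrow (f, phi) goes from f to phi \o f.                                *)
Definition coloring_quiver (D : code) (X : finMCBiquandleType)
    (S : set (X -> X)) : quiver :=
  @Quiver (MCB D -> X) ((MCB D -> X) * (X -> X))%type
    (Hom (MCB D) X) (Hom (MCB D) X `*` S)
    (fun e => e.1) (fun e => e.2 \o e.1).
Arguments coloring_quiver D X S : clear implicits.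

Definition in_degree (Q : quiver) (v : vertexT Q) : nat :=
  #|` fset_set [set e : arrowT Q | arrows Q e /\ target e = v]|.

Definition in_degree_polynomial (Q : quiver) : {poly int} :=
  \sum_(v \in vertices Q) ('X^(in_degree v) : {poly int}).

(* [in_degree] and [in_degree_polynomial] are meaningful for coloring quivers *)
(* because these are finite.                                                  *)
Lemma Hom_inj_gen (D : code) (X : mcBiquandleType) (f g : MCB D -> X) :
  Hom (MCB D) X f -> Hom (MCB D) X g ->
  (forall a, f (class (Gen a)) = g (class (Gen a))) -> f = g.
Proof.
move=> hf hg fg; apply/funext; elim/mcb_ind.
have hfu l v w : f (class (Und l v w)) = und l (f (class v)) (f (class w)).
  by rewrite -mcb_undE; exact: (hf l _ _).1.
have hgu l v w : g (class (Und l v w)) = und l (g (class v)) (g (class w)).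
  by rewrite -mcb_undE; exact: (hg l _ _).1.
have hfo l v w : f (class (Ovr l v w)) = ovr l (f (class v)) (f (class w)).
  by rewrite -mcb_ovrE; exact: (hf l _ _).2.
have hgo l v w : g (class (Ovr l v w)) = ovr l (g (class v)) (g (class w)).
  by rewrite -mcb_ovrE; exact: (hg l _ _).2.
have sw l v w : f (class v) = g (class v) -> f (class w) = g (class w) ->
    f (class (SwitchInv1 l v w)) = g (class (SwitchInv1 l v w))
 /\ f (class (SwitchInv2 l v w)) = g (class (SwitchInv2 l v w)).
  move=> fv fw.
  have E1 := (classE _ _).2 (cg_switchKV1 l v w).
  have E2 := (classE _ _).2 (cg_switchKV2 l v w).
  suff : (f (class (SwitchInv1 l v w)), f (class (SwitchInv2 l v w)))
       = (g (class (SwitchInv1 l v w)), g (class (SwitchInv2 l v w))).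
    by move=> [].
  apply: (bij_inj (switch_bij (s := X) l)) => /=.
  by rewrite -!hfu -!hfo -!hgu -!hgo E1 E2 fv fw.
elim=> [a|l v fv w fw|l v fv w fw|l v fv w fw|l v fv w fw|l v fv w fw|l v fv w fw].
- exact: fg.
- by rewrite hfu hgu fv fw.
- by rewrite hfo hgo fv fw.
- apply: (bij_inj (und_bij (s := X) l (f (class v)))) => /=.
  by rewrite -hfu fv -hgu ((classE _ _).2 (cg_undKV l w v)).
- apply: (bij_inj (ovr_bij (s := X) l (f (class v)))) => /=.
  by rewrite -hfo fv -hgo ((classE _ _).2 (cg_ovrKV l w v)).
- exact: (sw l v w fv fw).1.
- exact: (sw l v w fv fw).2.
Qed.

Lemma finite_Hom (D : code) (X : finMCBiquandleType) :
  finite_set (Hom (MCB D) X).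
Proof.
pose r (f : MCB D -> X) : {ffun semiarc D -> X} := [ffun a => f (class (Gen a))].
have rI : {in Hom (MCB D) X &, injective r}.
  move=> f g /set_mem hf /set_mem hg /ffunP rfg.
  by apply: Hom_inj_gen => // a; have := rfg a; rewrite !ffunE.
rewrite -(eq_finite_set (inj_card_eq rI)).
exact: finite_finset.
Qed.

Lemma finite_arrows (D : code) (X : finMCBiquandleType) (S : set (X -> X)) :
  finite_set (arrows (coloring_quiver D X S)).
Proof.
apply: finite_setX; first exact: finite_Hom.
apply: (@sub_finite_set _ _ [set: X -> X]) => //.
have fI : {in [set: X -> X] &, injective (fun f : X -> X => [ffun x => f x])}.
  move=> f g _ _ /ffunP fg; apply/funext => x.
  by have := fg x; rewrite !ffunE.
rewrite -(eq_finite_set (inj_card_eq fI)).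
exact: finite_finset.
Qed.

(* Main.v *)
(* A homomorphism from the fundamental mc-biquandle to X is a colouring of the edges of
   the diagram, so it suffices to find for each move a bijection between colourings that
   commutes with changing the colours along an arbitrary map X -> X.

   A kink or a classical bigon transmits colours unchanged along its strands, and the
   colours of its inner edges are determined by those of its outer edges.  Its crossings
   can hence be declared virtual, and virtual crossings can be erased at will.

   A move III keeps the outer edges of a triangle and recolours the inner ones.  The
   axioms give this for one choice of orientations.  For any other choice, one
   crossing of the triangle is created anew on the other side of the third strand by a move
   II, brought to the old one by a known move III, and cancelled with it. *)

Require Import Defs.
From mathcomp Require Import all_boot all_order all_algebra.
From mathcomp Require Import perm.
From mathcomp Require Import boolp classical_sets functions cardinality fsbigop.
Import Defs.

Set Implicit Arguments.
Unset Strict Implicit.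
Unset Printing Implicit Defensive.

Local Open Scope classical_set_scope.

(** * Colours around a crossing, a bigon and a triangle *)

Section Crossing.
Variable X : mcBiquandleType.
Implicit Types (l : crossing_type) (x y z : X).

(* u is the understrand and v the overstrand, with right and left halves ur, ul, vr, vl. *)
Definition sided l (ur ul vr vl : X) : Prop :=
  ul = und l ur vr /\ vl = ovr l vr ur.

(* o and u are the incoming and outgoing colours of the over- and the understrand, v and p
   say whether the crossing is virtual and whether it is positive. *)
Definition crossing_colors (v p : bool) l (o u : X * X) : Prop :=
  if v then o.1 = o.2 /\ u.1 = u.2
  else if p then sided l u.1 u.2 o.2 o.1 else sided l u.2 u.1 o.1 o.2.

Lemma und_inj l y : injective (fun x => und l x y).
Proof. exact: bij_inj (und_bij l y). Qed.

Lemma ovr_inj l y : injective (fun x => ovr l x y).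
Proof. exact: bij_inj (ovr_bij l y). Qed.

Lemma switch_inj l x y x' y' :
  ovr l y x = ovr l y' x' -> und l x y = und l x' y' -> x = x' /\ y = y'.
Proof.
move=> e1 e2; have := @bij_inj _ _ _ (switch_bij (s := X) l) (x, y) (x', y').
by rewrite /= e1 e2 => /(_ erefl) [].
Qed.

Lemma und_surj l y x : exists z, und l z y = x.
Proof. by have [g _ gK] := und_bij l y; exists (g x); rewrite gK. Qed.

Lemma ovr_surj l y x : exists z, ovr l z y = x.
Proof. by have [g _ gK] := ovr_bij l y; exists (g x); rewrite gK. Qed.

Lemma switch_surj l x y : exists p, ovr l p.2 p.1 = x /\ und l p.1 p.2 = y.
Proof.
have [g _ gK] := switch_bij (s := X) l.
by exists (g (x, y)); case: (gK (x, y)).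
Qed.

(* u1, u2 are the halves of the understrand and v1, v2 those of the overstrand; p and q
   tell whether u2 and v2 are the right ones. *)
Definition quad l (p q : bool) (u1 u2 v1 v2 : X) : Prop :=
  sided l (if p then u2 else u1) (if p then u1 else u2)
          (if q then v2 else v1) (if q then v1 else v2).

Lemma quadNl l p q u1 u2 v1 v2 :
  quad l (~~ p) q u1 u2 v1 v2 = quad l p q u2 u1 v1 v2.
Proof. by case: p. Qed.

Lemma quadNr l p q u1 u2 v1 v2 :
  quad l p (~~ q) u1 u2 v1 v2 = quad l p q u1 u2 v2 v1.
Proof. by case: q. Qed.

Definition quadN := (quadNl, quadNr).

(** According to [p] and [q], completing a crossing from one half of each strand inverts the switch
    map, inverts a right action of [und] or [ovr], or just evaluates both operations. *)
Lemma quad_ex l p q u1 v1 : exists u2 v2, quad l p q u1 u2 v1 v2.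
Proof.
rewrite /quad; case: p; case: q.
- have [[u2 v2] [/= e1 e2]] := switch_surj l v1 u1.
  by exists u2, v2.
- have [u2 e] := und_surj l v1 u1.
  by exists u2, (ovr l v1 u2).
- have [v2 e] := ovr_surj l u1 v1.
  by exists (und l u1 v2), v2.
- by exists (und l u1 v1), (ovr l v1 u1).
Qed.

Lemma quad_uniq l p q u1 v1 u2 v2 u2' v2' :
    quad l p q u1 u2 v1 v2 -> quad l p q u1 u2' v1 v2' ->
  u2 = u2' /\ v2 = v2'.
Proof.
rewrite /quad /sided; case: p; case: q.
- move=> [e1 e2] [e1' e2']; apply: (@switch_inj l).
    by rewrite -e2.
  by rewrite -e1.
- move=> [e1 e2] [e1' e2'].
  have e : u2 = u2' by apply: (@und_inj l v1); rewrite -e1.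
  by rewrite e2 e2' e.
- move=> [e1 e2] [e1' e2'].
  have e : v2 = v2' by apply: (@ovr_inj l u1); rewrite -e2.
  by rewrite e1 e1' e.
- by move=> [-> ->] [-> ->].
Qed.

(* The crossings top-middle, top-bottom and middle-bottom, a, b and c for short, have types
   j, k and l.  The strands t, m and n are triples: the outer edge near the crossing that
   comes first in the order a, b, c, the inner edge, and the other outer edge. *)
Definition triangle j k l (T M N : bool) (t m n : X * X * X) : Prop :=
  [/\ quad j T (~~ M) m.1.1 m.1.2 t.1.1 t.1.2,
      quad k T N n.1.1 n.1.2 t.2 t.1.2
    & quad l (~~ M) N n.2 n.1.2 m.2 m.1.2].

(** [T], [~~ M] and [N] tell whether the triangle lies to the right of the top, the middle and the
    bottom strand. The flip puts it on the other side of all three and reverses the order of the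
    crossings along each, so the outer edges change places. *)
Definition flippable j k l (T M N : bool) : Prop :=
  forall t m n, triangle j k l T M N t m n ->
  exists t2 m2 n2, triangle j k l (~~ T) (~~ M) (~~ N)
    (t.2, t2, t.1.1) (m.2, m2, m.1.1) (n.2, n2, n.1.1).

(** Here all colours are expressions in [t3], [m3] and [n2]. The witnesses solve three of the six
    new equations by definition; the other three are the exchange laws, whose indices are the types
    at c, b, a in this order. *)
Lemma flippable_base j k l : admissible l k j -> flippable j k l true false false.
Proof.
move=> adm [[t1 t2] t3] [[m1 m2] m3] [[n1 n2] n3].
case=> [[/= -> ->] [/= -> ->] [/= -> ->]].
exists (ovr j t3 m3), (und j m3 t3), (und l (und k n2 t3) (und j m3 t3)).
by split; split=> //=;
  first [exact: ovr_ovr|exact: und_und|apply/esym; exact: und_ovr].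
Qed.

(* Add a crossing a' beyond b and c.  The given flip of the triangle a', b, c brings it
   next to a, which it cancels.  What remains is the flipped triangle a, b, c.  The same
   works with b or c in place of a. *)
Lemma flippable_a j k l T M N : flippable j k l T M (~~ N) -> flippable j k l T M N.
Proof.
move=> H [[t1 t2] t3] [[m1 m2] m3] [[n1 n2] n3] [/= Ha Hb Hc].
have [m' [t' Ha']] := quad_ex j (~~ T) M m3 t3.
have [|t'' [m'' [n'' [/= Ka Kb Kc]]]] := H (t', t3, t2) (m', m3, m2) (n1, n2, n3).
  by split=> /=; move: Ha' Hb Hc; rewrite !quadN.
have [e1 e2] : m'' = m1 /\ t'' = t1.
  by apply: quad_uniq Ka _; move: Ha; rewrite !quadN.
exists t', m', n''; move: Ha' Kb Kc; rewrite e1 e2 => Ha' Kb Kc.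
by split=> /=; move: Ha' Kb Kc; rewrite !quadN.
Qed.

Lemma flippable_b j k l T M N : flippable j k l T (~~ M) N -> flippable j k l T M N.
Proof.
move=> H [[t1 t2] t3] [[m1 m2] m3] [[n1 n2] n3] [/= Ha Hb Hc].
have [n' [t' Hb']] := quad_ex k (~~ T) (~~ N) n3 t1.
have [|t'' [m'' [n'' [/= Ka Kb Kc]]]] := H (t2, t1, t') (m1, m2, m3) (n', n3, n2).
  by split=> /=; move: Ha Hb' Hc; rewrite !quadN.
have [e1 e2] : n'' = n1 /\ t'' = t3.
  by apply: quad_uniq Kb _; move: Hb; rewrite !quadN.
exists t', m'', n'; move: Ka Hb' Kc; rewrite e1 e2 => Ka Hb' Kc.
by split=> /=; move: Ka Hb' Kc; rewrite !quadN.
Qed.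

Lemma flippable_c j k l T M N : flippable j k l (~~ T) M N -> flippable j k l T M N.
Proof.
move=> H [[t1 t2] t3] [[m1 m2] m3] [[n1 n2] n3] [/= Ha Hb Hc].
have [n' [m' Hc']] := quad_ex l M (~~ N) n1 m1.
have [|t'' [m'' [n'' [/= Ka Kb Kc]]]] := H (t1, t2, t3) (m2, m1, m') (n2, n1, n').
  by split=> /=; move: Ha Hb Hc'; rewrite !quadN.
have [e1 e2] : n'' = n3 /\ m'' = m3.
  by apply: quad_uniq Kc _; move: Hc; rewrite !quadN.
exists t'', m', n'; move: Ka Kb Hc'; rewrite e1 e2 => Ka Kb Hc'.
by split=> /=; move: Ka Kb Hc'; rewrite !quadN.
Qed.

(** Each of [flippable_a], [flippable_b] and [flippable_c] reverses one of the three signs, so all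
    eight patterns reduce to the base case. *)
Lemma triangle_flip j k l T M N : admissible l k j -> flippable j k l T M N.
Proof.
move=> /flippable_base H.
have HT T' : flippable j k l T' false false.
  by case: T'; [|apply: flippable_c].
have HM T' M' : flippable j k l T' M' false.
  by case: M'; [apply: flippable_b|]; exact: HT.
by case: N; [apply: flippable_a|]; exact: HM.
Qed.

Lemma triangle_uniq j k l T M N t m n t2 m2 n2 t2' m2' n2' :
    triangle j k l T M N (t.1, t2, t.2) (m.1, m2, m.2) (n.1, n2, n.2) ->
    triangle j k l T M N (t.1, t2', t.2) (m.1, m2', m.2) (n.1, n2', n.2) ->
  [/\ t2 = t2', m2 = m2' & n2 = n2'].
Proof.
move=> [/= Ha Hb _] [/= Ha' Hb' _].
have [-> ->] := quad_uniq Ha Ha'.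
by have [-> _] := quad_uniq Hb Hb'.
Qed.

(* A pair of consecutive passages of a strand is given by the colours before, between and
   after them; arc true s and arc false s are the ends at the first and at the second. *)
Definition arc (b : bool) (s : X * X * X) : X * X :=
  if b then (s.1.1, s.1.2) else (s.1.2, s.2).

Definition bigon_colors l (p t : bool) (o u : X * X * X) : Prop :=
  crossing_colors false p l (arc true o) (arc t u)
  /\ crossing_colors false (~~ p) l (arc false o) (arc (~~ t) u).

(** As the signs are opposite, the inner edges lie on the same sides at both crossings. The two
    outer pairs thus solve the same equations with the same inner pair, and these have only one
    solution. *)
Lemma bigon_through l p t o u : bigon_colors l p t o u ->
  o.1.1 = o.2 /\ u.1.1 = u.2.
Proof.
rewrite /bigon_colors /crossing_colors /sided; move: o u => [[x y] z] [[x' y'] z'].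
case: p; case: t => /= -[[e1 e2] [e3 e4]].
- have e : x' = z' by apply: (@und_inj l y); rewrite -e1.
  by rewrite e2 e4 e.
- by rewrite e1 e2 e3 e4.
- have e : x = z by apply: (@ovr_inj l y'); rewrite -e2.
  by rewrite e1 e3 e.
- by apply/and_comm; split; apply/esym;
    have [] := @switch_inj l x' z z' x; rewrite -?e1 -?e2.
Qed.

Lemma bigon_ex l p t x z : exists y y', bigon_colors l p t (x, y, x) (z, y', z).
Proof.
rewrite /bigon_colors /crossing_colors /sided; case: p; case: t => /=.
- have [y e] := ovr_surj l z x.
  by exists y, (und l z y).
- have [[y' y] [/= e1 e2]] := switch_surj l x z.
  by exists y, y'.
- have [y' e] := und_surj l x z.
  by exists (ovr l x y'), y'.
- by exists (ovr l x z), (und l z x).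
Qed.

Lemma bigon_uniq l p t x z y y' w w' :
    bigon_colors l p t (x, y, x) (z, y', z) ->
    bigon_colors l p t (x, w, x) (z, w', z) ->
  y = w /\ y' = w'.
Proof.
rewrite /bigon_colors /crossing_colors /sided; case: p; case: t => /=.
- move=> [[-> e1] _] [[-> e2] _].
  have -> : y = w by apply: (@ovr_inj l z); rewrite -e1.
  by [].
- move=> [[e1 e2] _] [[e3 e4] _].
  by apply/and_comm; apply: (@switch_inj l); rewrite -?e1 -?e2.
- move=> [[e1 ->] _] [[e2 ->] _].
  have -> : y' = w' by apply: (@und_inj l x); rewrite -e1.
  by [].
- by move=> [[-> ->] _] [[-> ->] _].
Qed.

(* t, m and n tell whether a is before b on the top strand, a before c on the middle one,
   and b before c on the bottom one. *)
Definition triangle_colors (va vc pa pb pc t m n : bool) j k l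
    (T M N : X * X * X) : Prop :=
  [/\ crossing_colors va pa j (arc t T) (arc m M),
      crossing_colors va pb k (arc (~~ t) T) (arc n N)
    & crossing_colors vc pc l (arc (~~ m) M) (arc (~~ n) N)].

Definition orient (b : bool) (s : X * X * X) : X * X * X :=
  if b then s else (s.2, s.1.2, s.1.1).

(** The side of a strand on which the triangle lies can be read off at either of its two crossings.
    The sign equations say that both readings agree: [pa (+) m = pb (+) n] for the top strand,
    [pa (+) t = pc (+) n] for the middle one, [pb (+) t = pc (+) m] for the bottom one. *)
Lemma triangle_colorsE (pa pb pc t m n : bool) j k l T M N :
    pa (+) t (+) m = pb (+) t (+) n -> pb (+) t (+) n = pc (+) m (+) n ->
  triangle_colors false false pa pb pc t m n j k l T M N
  <-> triangle j k l (pa (+) m) (pa (+) t) (pb (+) t)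
        (orient t T) (orient m M) (orient n N).
Proof.
rewrite /triangle_colors /triangle /crossing_colors /quad /arc /orient.
by case: t; case: m; case: n; case: pa; case: pb; case: pc.
Qed.

Lemma triangle_colors_flip (va vc pa pb pc t m n : bool) j k l T M N :
    (vc -> va) -> admissible l k j ->
    pa (+) t (+) m = pb (+) t (+) n -> pb (+) t (+) n = pc (+) m (+) n ->
    triangle_colors va vc pa pb pc t m n j k l T M N ->
  exists x y z, triangle_colors va vc pa pb pc (~~ t) (~~ m) (~~ n) j k l
    (T.1.1, x, T.2) (M.1.1, y, M.2) (N.1.1, z, N.2).
Proof.
move=> vca adm e1 e2; case: va vca => [_|].
  move: T M N => [[T1 T2] T3] [[M1 M2] M3] [[N1 N2] N3].
  rewrite /triangle_colors /crossing_colors /arc => H.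
  (* The middle and the bottom strand can change colour only at c. The move puts c at the other end
     of the inner edge, which thus takes the outer colour found beyond c before. *)
  exists T1, (if m then M3 else M1), (if n then N3 else N1).
  by case: t m n H {e1 e2} => [] [] [] /= [[-> ->] [-> ->] H]; split.
case: vc => [/(_ isT) //|_].
have f1 : pa (+) ~~ t (+) ~~ m = pb (+) ~~ t (+) ~~ n.
  by rewrite !addbN !addNb !negbK.
have f2 : pb (+) ~~ t (+) ~~ n = pc (+) ~~ m (+) ~~ n.
  by rewrite !addbN !addNb !negbK.
move=> /(triangle_colorsE _ _ _ _ _ _ e1 e2)/(triangle_flip adm).
case=> x [y [z H]]; exists x, y, z; apply/(triangle_colorsE _ _ _ _ _ _ f1 f2).
by rewrite !addbN; move: H; case: t m n {e1 e2 f1 f2} => [] [] [].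
Qed.

Lemma triangle_colors_uniq (va vc pa pb pc t m n : bool) j k l T M N
    x y z x' y' z' :
    pa (+) t (+) m = pb (+) t (+) n -> pb (+) t (+) n = pc (+) m (+) n ->
    (vc -> va) ->
    triangle_colors va vc pa pb pc t m n j k l
      (T.1, x, T.2) (M.1, y, M.2) (N.1, z, N.2) ->
    triangle_colors va vc pa pb pc t m n j k l
      (T.1, x', T.2) (M.1, y', M.2) (N.1, z', N.2) ->
  [/\ x = x', y = y' & z = z'].
Proof.
move=> e1 e2; case: va => [_|].
  rewrite /triangle_colors /crossing_colors /arc {e1 e2}.
  case: t m n => [] [] [] /= [[a1 a2] [a3 a4] _] [[a5 a6] [a7 a8] _];
    by split; congruence.
case: vc => [/(_ isT) //|_].
move=> /(triangle_colorsE _ _ _ _ _ _ e1 e2) H.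
move=> /(triangle_colorsE _ _ _ _ _ _ e1 e2) H'.
pose sw (b : bool) (s : X * X) := if b then s else (s.2, s.1).
have E b (s : X * X) w :
    orient b (s.1, w, s.2) = ((sw b s).1, w, (sw b s).2) by case: b.
by rewrite !E in H H'; apply: triangle_uniq H H'.
Qed.

End Crossing.

(** * Colours around a kink *)

Section Kink.
Variable X : finMCBiquandleType.

(* Finiteness of X is needed here: the diagonal map is a priori only injective. *)
Lemma diag_surj (x : X) : exists y, und Single y y = x /\ ovr Single y y = x.
Proof.
have inj : injective (fun y : X => und Single y y).
  move=> y z /= e; have [] // := @switch_inj X Single y y z z.
  by rewrite !ovr_diag.
have [g _ gK] := injF_bij inj.
by exists (g x); rewrite ovr_diag gK.
Qed.

(** The pair [(y, y)] is already the image of a diagonal pair, and the switch map is injective. *)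
Lemma switch_diag (x z y : X) : und Single x z = y -> ovr Single z x = y -> x = z.
Proof.
have [w [e1 e2]] := diag_surj y; move=> e3 e4.
by have [] := @switch_inj X Single x z w w; rewrite ?e1 ?e2 // => -> ->.
Qed.

Definition kink_colors (p b : bool) (s : X * X * X) :=
  crossing_colors false p Single (arc b s) (arc (~~ b) s).

(** The inner edge is either the right half of both strands, where the diagonal axiom applies, or
    the left half of both, where [switch_diag] does. *)
Lemma kink_through p b s : kink_colors p b s -> s.1.1 = s.2.
Proof.
rewrite /kink_colors /crossing_colors /sided; move: s => [[x y] z].
case: p; case: b => /= -[e1 e2].
- by rewrite e1 e2 ovr_diag.
- by apply: (switch_diag (y := y)).
- by apply/esym; apply: (switch_diag (y := y)).
- by rewrite e1 e2 ovr_diag.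
Qed.

Lemma kink_ex p b x : exists y, kink_colors p b (x, y, x).
Proof.
rewrite /kink_colors /crossing_colors /sided.
have [y [e1 e2]] := diag_surj x.
case: p; case: b => /=; [exists y|exists (und Single x x)
  |exists (und Single x x)|exists y]; by rewrite ?ovr_diag ?e1 ?e2.
Qed.

Lemma kink_uniq p b x y z : kink_colors p b (x, y, x) ->
  kink_colors p b (x, z, x) -> y = z.
Proof.
rewrite /kink_colors /crossing_colors /sided.
case: p; case: b => /= -[e1 e2] [e3 e4].
- by have [] := @switch_inj X Single y y z z; rewrite -?e1 -?e2.
- by rewrite e1 e3.
- by rewrite e1 e3.
- by have [] := @switch_inj X Single y y z z; rewrite -?e1 -?e2.
Qed.

End Kink.

(** * Colourings and homomorphisms *)

Definition ends (D : code) (X : Type) (c : edge D -> X) (v : passage D) : X * X :=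
  (c (edge_in v), c (edge_out v)).

Section Colorings.
Variables (D : code) (X : mcBiquandleType).
Implicit Types (c : edge D -> X) (f : MCB D -> X).

Definition colors c : Prop := forall x : crossing D,
  crossing_colors (virtual x) (positive x) (type_of x)
    (ends c (x, true)) (ends c (x, false)).

Definition coloring_of f : edge D -> X :=
  fun e => f (class (Gen (semiarc_of e))).

Lemma glued_sym : symmetric (@glued D).
Proof.
move=> e e'; apply: eq_existsb => v; congr andb.
by rewrite orbC; congr orb; rewrite andbC.
Qed.

Lemma semiarc_of_glued (e e' : edge D) : glued e e' -> semiarc_of e = semiarc_of e'.
Proof.
move=> ee'; apply: val_inj; apply/setP => x; rewrite !inE.
by apply: same_connect (connect1 ee') _; exact: sym_connect_sym glued_sym.
Qed.

Lemma colors_glued c e e' : colors c -> glued e e' -> c e = c e'.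
Proof.
move=> cc /existsP[[x b] /= /andP[vx]]; have := cc x; rewrite /crossing_colors vx /ends /=.
by case: b => -[e1 e2] /orP[] /andP[/eqP -> /eqP ->].
Qed.

Lemma colors_connect c e e' : colors c -> connect (@glued D) e e' -> c e = c e'.
Proof.
move=> cc /connectP[p pth ->] {e'}; elim: p e pth => //= e' p IHp e /andP[ee' pth].
by rewrite (colors_glued cc ee') IHp.
Qed.

Lemma semiarc_of_surj (a : semiarc D) : exists e, semiarc_of e = a.
Proof. by have /imsetP[e _ ea] := valP a; exists e; apply: val_inj. Qed.

Lemma colors_coloring_of f : Hom (MCB D) X f -> colors (coloring_of f).
Proof.
move=> hf x; rewrite /crossing_colors /ends /coloring_of.
case: ifPn => vx.
  have gl b : glued (edge_in (x, b)) (edge_out (x, b)).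
    by apply/existsP; exists (x, b); rewrite vx !eqxx.
  by split; congr (f (class (Gen _))); apply: semiarc_of_glued.
have e1 := (classE _ _).2 (cg_under vx); have e2 := (classE _ _).2 (cg_over vx).
rewrite -mcb_undE in e1; rewrite -mcb_ovrE in e2.
have {}e1 := etrans (congr1 f e1) (hf _ _ _).1.
have {}e2 := etrans (congr1 f e2) (hf _ _ _).2.
by move: e1 e2; rewrite /sided /under_left /over_left /under_right /over_right;
  case: ifP.
Qed.

Definition und_inv l (y x : X) : X := sval (cid (und_surj l y x)).
Definition ovr_inv l (y x : X) : X := sval (cid (ovr_surj l y x)).
Definition switch_inv l (x y : X) : X * X := sval (cid (switch_surj l x y)).

Lemma und_invE l y x : und l (und_inv l y x) y = x.
Proof. exact: svalP (cid (und_surj l y x)). Qed.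

Lemma ovr_invE l y x : ovr l (ovr_inv l y x) y = x.
Proof. exact: svalP (cid (ovr_surj l y x)). Qed.

Lemma switch_invE l x y (p := switch_inv l x y) :
  ovr l p.2 p.1 = x /\ und l p.1 p.2 = y.
Proof. exact: svalP (cid (switch_surj l x y)). Qed.

Section Eval.
Variable a : semiarc D -> X.

Fixpoint eval (w : word (semiarc D)) : X :=
  match w with
  | Gen s => a s
  | Und l v w => und l (eval v) (eval w)
  | Ovr l v w => ovr l (eval v) (eval w)
  | UndInv l v w => und_inv l (eval v) (eval w)
  | OvrInv l v w => ovr_inv l (eval v) (eval w)
  | SwitchInv1 l v w => (switch_inv l (eval v) (eval w)).1
  | SwitchInv2 l v w => (switch_inv l (eval v) (eval w)).2
  end.

Lemma eval_congruent : colors (a \o @semiarc_of D) ->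
  forall v w, congruent v w -> eval v = eval w.
Proof.
move=> ca v w; elim=> {v w} /=; do ?[by [] | by move=> *; congruence].
- by move=> x; exact: ovr_diag.
- by move=> l x y; apply: (@und_inj X l (eval y)); rewrite und_invE.
- by move=> l x y; rewrite und_invE.
- by move=> l x y; apply: (@ovr_inj X l (eval y)); rewrite ovr_invE.
- by move=> l x y; rewrite ovr_invE.
- move=> l x y; have [e1 e2] := switch_invE l (ovr l (eval y) (eval x))
    (und l (eval x) (eval y)).
  by have [] := switch_inj e1 e2.
- move=> l x y; have [e1 e2] := switch_invE l (ovr l (eval y) (eval x))
    (und l (eval x) (eval y)).
  by have [] := switch_inj e1 e2.
- by move=> l x y; case: (switch_invE l (eval x) (eval y)).
- by move=> l x y; case: (switch_invE l (eval x) (eval y)).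
- by move=> j k l x y z adm; exact: ovr_ovr.
- by move=> j k l x y z adm; exact: und_ovr.
- by move=> j k l x y z adm; exact: und_und.
- move=> x vx; have := ca x; rewrite /crossing_colors (negPf vx) /ends /=.
  by rewrite /sided /under_left /over_left /under_right /over_right;
    case: ifP => _ [].
- move=> x vx; have := ca x; rewrite /crossing_colors (negPf vx) /ends /=.
  by rewrite /sided /under_left /over_left /under_right /over_right;
    case: ifP => _ [].
Qed.

End Eval.

(** A colouring is constant on each semiarc, so it assigns values to the generators; by
    [eval_congruent] the evaluation of words descends to their classes. *)
Lemma coloring_of_onto c : colors c ->
  exists2 f, Hom (MCB D) X f & coloring_of f = c.
Proof.
move=> cc; pose a s := c (sval (cid (semiarc_of_surj s))).
have ac : a \o @semiarc_of D = c.
  apply/funext => e; rewrite /= /a; case: cid => e' /= ee'.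
  apply: colors_connect cc _; move/(congr1 val)/setP/(_ e): ee'.
  by rewrite !inE connect0.
have ca : colors (a \o @semiarc_of D) by rewrite ac.
have ev w : eval a (rep (class w)) = eval a w.
  by apply: (eval_congruent ca); exact: class_rep.
exists (fun x => eval a (rep x)).
  move=> l x y; split; rewrite /und /ovr /= ?/mcb_und ?/mcb_ovr.
    exact: ev (Und _ _ _).
  exact: ev (Ovr _ _ _).
by rewrite -[RHS]ac; apply/funext => e; rewrite /coloring_of ev.
Qed.

Lemma coloring_of_inj f g : Hom (MCB D) X f -> Hom (MCB D) X g ->
  coloring_of f = coloring_of g -> f = g.
Proof.
move=> hf hg fg; apply: Hom_inj_gen => // a.
by have [e <-] := semiarc_of_surj a; have := congr1 (@^~ e) fg.
Qed.

End Colorings.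

(** * From colourings to in-degrees *)

Lemma Hom_comp (A B C : mcBiquandleType) (f : A -> B) (g : B -> C) :
  Hom A B f -> Hom B C g -> Hom A C (g \o f).
Proof.
move=> hf hg l x y; have [fu fo] := hf l x y.
by split; rewrite /= (fu, fo) ((hg l _ _).1, (hg l _ _).2).
Qed.

Definition same_polynomial (X : finMCBiquandleType) (S : set (X -> X))
    (D D' : code) : Prop :=
  in_degree_polynomial (coloring_quiver D X S)
  = in_degree_polynomial (coloring_quiver D' X S).

Section Transfer.
Variables (X : finMCBiquandleType) (S : set (X -> X)) (D D' : code).
Hypothesis S_End : S `<=` End X.

(** As [h] commutes with endomorphisms, pairing it with the identity of [S] gives an isomorphism of
    quivers, which preserves in-degrees. *)
Lemma same_polynomial_bij (h : (MCB D -> X) -> (MCB D' -> X)) :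
    set_bij (Hom (MCB D) X) (Hom (MCB D') X) h ->
    (forall f phi, Hom (MCB D) X f -> End X phi -> h (phi \o f) = phi \o h f) ->
  same_polynomial S D D'.
Proof.
move=> hB hE; rewrite /same_polynomial /in_degree_polynomial /=.
rewrite [RHS](reindex_fsbig h _ _ _ hB) /=.
apply: eq_fsbigr => f /set_mem hf; congr (_ ^+ _)%R; rewrite /in_degree /=.
set A := [set e | _]; set B := [set e | _].
have AB : (fun e => (h e.1, e.2)) @` A = B.
  apply/seteqP; split.
    move=> _ [[g phi] [[/= hg Sphi] e] <-].
    split; first by split=> //=; exact: (set_bij_homo hB).
    by rewrite /= -hE ?e //; exact: S_End.
  move=> [g' phi] [[/= hg' Sphi] e].
  have [g hg gE] := set_bij_surj hB hg'.
  exists (g, phi); last by rewrite /= gE.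
  split=> //=.
  apply: (set_bij_inj hB); rewrite ?inE //.
    by apply: Hom_comp hg _; exact: S_End.
  by rewrite hE ?gE //; exact: S_End.
have AI : {in A &, injective (fun e => (h e.1, e.2))}.
  move=> [g phi] [g' phi'] /set_mem[[/= hg _] _] /set_mem[[/= hg' _] _] [e ->].
  by congr pair; apply: (set_bij_inj hB); rewrite ?inE.
have /finite_setP[n An] : finite_set A.
  by apply: sub_finite_set (finite_arrows D S) => e [].
rewrite (card_fset_set An); apply/esym/card_fset_set; rewrite -AB.
exact: card_eq_trans (inj_card_eq AI) An.
Qed.

(** A relation is easier to exhibit than a map. The first four conditions make [Z] a bijection
    between colourings; the last one makes it commute with endomorphisms. *)
Lemma same_polynomial_transfer (Z : (edge D -> X) -> (edge D' -> X) -> Prop) :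
    (forall c, colors c -> exists2 c', colors c' & Z c c') ->
    (forall c', colors c' -> exists2 c, colors c & Z c c') ->
    (forall c c1 c2, colors c -> colors c1 -> colors c2 ->
      Z c c1 -> Z c c2 -> c1 = c2) ->
    (forall c' c1 c2, colors c' -> colors c1 -> colors c2 ->
      Z c1 c' -> Z c2 c' -> c1 = c2) ->
    (forall (phi : X -> X) c c', Z c c' -> Z (phi \o c) (phi \o c')) ->
  same_polynomial S D D'.
Proof.
move=> Ztot Zonto Zfun Zinj Znat.
have HomZ f : Hom (MCB D) X f ->
    exists2 g, Hom (MCB D') X g & Z (coloring_of f) (coloring_of g).
  move=> /colors_coloring_of/Ztot[c' /coloring_of_onto[g hg <-] fg].
  by exists g.
have ZHom g : Hom (MCB D') X g ->
    exists2 f, Hom (MCB D) X f & Z (coloring_of f) (coloring_of g).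
  move=> /colors_coloring_of/Zonto[c' /coloring_of_onto[f hf <-] fg].
  by exists f.
(* To be total, [h] needs a default value [g0] at maps that are no homomorphisms; if there are no
   homomorphisms at all, both sums are empty. *)
have [[f0 /HomZ[g0 _ _]]|none] := pselect (exists f, Hom (MCB D) X f); last first.
  rewrite /same_polynomial /in_degree_polynomial /=.
  have -> : Hom (MCB D) X = set0.
    by apply/seteqP; split=> // f hf; case: none; exists f.
  suff -> : Hom (MCB D') X = set0 by rewrite !fsbig_set0.
  by apply/seteqP; split=> // g /ZHom[f hf _]; case: none; exists f.
have [f|h hP] := choice (P := fun f g => Hom (MCB D) X f ->
    Hom (MCB D') X g /\ Z (coloring_of f) (coloring_of g)).
  have [/HomZ[g hg fg]|nf] := pselect (Hom (MCB D) X f); first by exists g.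
  by exists g0 => /nf.
apply: (@same_polynomial_bij h).
  split.
  - by move=> f /hP[].
  - move=> f g /set_mem hf /set_mem hg e; apply: coloring_of_inj => //.
    have [hhf Zf] := hP f hf; have [_ Zg] := hP g hg; rewrite -e in Zg.
    by apply: Zinj Zf Zg; exact: colors_coloring_of.
  - move=> g hg; have [f hf Zf] := ZHom g hg; exists f => //.
    have [hhf Zhf] := hP f hf; apply: coloring_of_inj => //.
    by apply: Zfun Zhf Zf; exact: colors_coloring_of.
move=> f phi hf hphi; have [hhf Zf] := hP f hf.
have hpf := Hom_comp hf hphi; have [hhpf Zpf] := hP _ hpf.
have hphf := Hom_comp hhf hphi.
apply: coloring_of_inj => //.
apply: (Zfun (coloring_of (phi \o f))) => //; last exact: Znat Zf.
- exact: colors_coloring_of.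
- exact: colors_coloring_of.
- exact: colors_coloring_of.
Qed.

End Transfer.

(** * Erasing virtual crossings *)

(** [f] permutes a finite type, so [v] comes back within [#|T|] steps and the search succeeds. As
    [s] starts at [f v], index [i] stands for the iterate [i.+1]. *)
Lemma find_traject (T : finType) (f : T -> T) (p : pred T) v
    (s := traject f (f v) #|T|) :
  injective f -> p v ->
  exists2 i, nth v s (find p s) = iter i.+1 f v
    & forall j, (j < i)%N -> ~~ p (iter j.+1 f v).
Proof.
move=> f_inj pv; have ps : has p s.
  apply/hasP; exists v => //.
  have : fconnect f (f v) v by rewrite fconnect_sym ?fconnect1.
  rewrite fconnect_orbit /orbit => /trajectP[j ltj ->]; apply/trajectP.
  by exists j => //; apply: leq_trans ltj _; exact: max_card.
have lti : (find p s < #|T|)%N by move: ps; rewrite has_find size_traject.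
exists (find p s).
  by rewrite (set_nth_default (f v)) ?size_traject // nth_traject // -iterSr.
move=> j ltj; have := before_find (f v) ltj.
by rewrite nth_traject ?(ltn_trans ltj) // -iterSr => ->.
Qed.

Section Reach.
Variables (D : code) (K : {set crossing D}).

(* reach w v: all passages after w up to v, the latter included, are at crossings in K. *)
Inductive reach (w : passage D) : passage D -> Prop :=
| reach_refl : reach w w
| reach_succ v : reach w v -> (succ D v).1 \in K -> reach w (succ D v).

(** Going backwards from [v] is deterministic, [succ] being injective, and both paths stop at the
    first passage outside [K]. *)
Lemma reach_uniq w w' v : w.1 \notin K -> w'.1 \notin K ->
  reach w v -> reach w' v -> w = w'.
Proof.
move=> wK w'K r; elim: r => {v} [|v r IHr vK] r'.
  by case: r' wK => // v _ ->.
case E : _ / r' => [|u r' uK]; first by rewrite E (negPf w'K) in vK.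
by apply: IHr; rewrite (perm_inj E).
Qed.

Lemma reach_component w v : reach w v -> component_of v = component_of w.
Proof.
elim=> // u _ <- _; apply/eqP; rewrite component_ofP porbit_sym.
by have := mem_porbit (succ D) 1 u; rewrite expg1.
Qed.

Lemma succ_outside_reach v : v.1 \notin K ->
  exists2 u, reach v u & succ_outside K v = succ D u.
Proof.
pose p (u : passage D) := u.1 \notin K.
move=> vK; have [i iE iK] := find_traject (p := p) (@perm_inj _ (succ D)) vK.
exists (iter i (succ D) v); last exact: iE.
elim: i {iE} iK => [_|i IHi iK]; first exact: reach_refl.
apply: reach_succ; first by apply: IHi => j /ltnW; exact: iK.
by have := iK i (ltnSn i); rewrite /p negbK.
Qed.

Lemma reach_colors (X : mcBiquandleType) (c : edge D -> X) w v :
    (forall x, x \in K -> virtual x) -> colors c -> reach w v ->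
  c (inl v) = c (inl w).
Proof.
move=> Kv cc; elim=> // u _ <- uK.
apply/esym/colors_glued => //; apply/existsP; exists (succ D u).
by rewrite (Kv _ uK) /edge_in permK !eqxx.
Qed.

End Reach.

Definition free_component (D : code) : finType :=
  {k : component D | [forall v, component_of v != k]}.

Definition free (D : code) (k : component D)
    (kP : [forall v : passage D, component_of v != k]) : free_component D :=
  exist _ k kP.

Section Erase.
Variables (X : finMCBiquandleType) (S : set (X -> X)) (D D' : code).
Variables (K : {set crossing D}) (nx : passage D -> passage D).
Hypothesis S_End : S `<=` End X.
Hypothesis K_virtual : forall x, x \in K -> virtual x.
Hypothesis nx_reach : forall v, v.1 \notin K ->
  exists2 u, reach K v u & nx v = succ D u.

(** Virtual crossings transmit colours, so an edge of [D'] corresponds to a whole run of edges of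
    [D], separated by crossings in [K] and all of one colour. *)
Lemma same_polynomial_presents : presents K nx D' -> same_polynomial S D D'.
Proof.
move=> [f [sw [g /= [[f_inj fK] [g' gK g'K] f_cross g_comp f_succ]]]].
pose F (v : passage D') : passage D := (f v.1, v.2 (+) sw v.1).
have {}g_comp v : g (component_of v) = component_of (F v) := g_comp v.
have {}f_succ v : F (succ D' v) = nx (F v) := f_succ v.
have FK v : (F v).1 \notin K by rewrite fK; exact: codom_f.
have F_inj : injective F.
  move=> [x b] [y b'] [/f_inj <-]; rewrite /= => /addIb <- //.
have F_onto v : v.1 \notin K -> exists v', v = F v'.
  rewrite fK => /codomP[x vx]; exists (x, v.2 (+) sw x).
  by rewrite /F /= -addbA addbb addbF -vx -surjective_pairing.
(* Exchanging the names at a virtual crossing also reverses its sign, but its relation is symmetric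
   in the two strands and independent of the sign. *)
have crelF (E : passage D -> X * X) x :
    crossing_colors (virtual x) (positive x) (type_of x)
      (E (F (x, true))) (E (F (x, false)))
    <-> crossing_colors (virtual (f x)) (positive (f x)) (type_of (f x))
          (E (f x, true)) (E (f x, false)).
  have [-> -> swv] := f_cross x.
  have -> : type_of x = type_of (f x).
    rewrite /type_of -(inj_eq (can_inj gK)) !g_comp /=.
    by rewrite /F /=; case: (sw x); rewrite //= eq_sym.
  rewrite /F /=; case: (sw x) swv => [/(_ isT)|_]; last by rewrite addbF.
  have [-> _ _] := f_cross x.
  by move=> ->; exact: and_comm.
have in_reach v : reach K (F ((succ D')^-1%g v)) ((succ D)^-1%g (F v)).
  have [u ru] := nx_reach (FK ((succ D')^-1%g v)).
  by rewrite -f_succ permKV => ->; rewrite permK.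
(* Each passage of [D] is on the run of a surviving passage, or on a component that loses all its
   crossings. *)
have dich v : (exists v', reach K (F v') v) \/
    (exists k : free_component D',
       component_of v = g (val k)).
  have [kP|] := boolP [forall v', component_of v' != g' (component_of v)].
    by right; exists (free kP); rewrite /= g'K.
  rewrite negb_forall => /existsP[v']; rewrite negbK => /eqP cv'; left.
  have: v \in porbit (succ D) (F v').
    by rewrite -component_ofP -g_comp cv' g'K.
  case/porbitP => i ->; elim: i => [|i [w rw]].
    by exists v'; rewrite expg0 perm1; exact: reach_refl.
  rewrite expgSr permM; set u := fun_of_perm _ (F v') in rw *.
  have [uK|/F_onto[w' ->]] := boolP ((succ D u).1 \in K).
    by exists w; exact: reach_succ.
  by exists w'; exact: reach_refl.
have free_K (k : free_component D') v :
    component_of v = g (val k) -> v.1 \in K.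
  move=> vk; apply: contraT => /F_onto[v' e].
  have /forallP/(_ v')/eqP[] := valP k.
  by apply: (can_inj gK); rewrite g_comp -vk e.
have free_reach (k : free_component D') v v' :
    component_of v = g (val k) -> reach K (F v') v -> False.
  move=> vk /reach_component; rewrite vk => e.
  by have := FK v'; rewrite (free_K k).
(* A component without crossings in [D'] has either lost those it had in [D] (second clause) or had
   none there (third clause). *)
pose Z (c : edge D -> X) (c' : edge D' -> X) :=
  [/\ forall v, c' (inl v) = c (inl (F v)),
      forall k v, component_of v = g (val k) -> c' (inr k) = c (inl v)
    & forall k k0, g (val k) = val k0 -> c' (inr k) = c (inr k0)].
apply: (same_polynomial_transfer S_End (Z := Z)).
- move=> c cc.
  have [k|q qP] := choice (P := fun (k : free_component D') (x : X) =>
      (forall v, component_of v = g (val k) -> x = c (inl v))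
      /\ (forall k0, g (val k) = val k0 -> x = c (inr k0))).
    have [kP|] := boolP [forall v, component_of v != g (val k)].
      exists (c (inr (free kP))); split=> [v vk|k0 kk0].
        by have /forallP/(_ v) := kP; rewrite vk eqxx.
      by congr (c (inr _)); apply: val_inj.
    rewrite negb_forall => /existsP[v]; rewrite negbK => /eqP vk.
    exists (c (inl v)); split=> [w wk|k0 kk0]; last first.
      by have /forallP/(_ v) := valP k0; rewrite -kk0 vk eqxx.
    have : w \in porbit (succ D) v by rewrite -component_ofP vk wk.
    case/porbitP => i wE; apply/esym; apply: (reach_colors K_virtual cc).
    elim: i w wk wE => [|i IHi] w wk wE.
      by rewrite wE expg0 perm1; exact: reach_refl.
    rewrite wE expgSr permM in wk *; apply: reach_succ; last exact: (free_K k).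
    apply: IHi => //; rewrite -wk; apply/eqP; rewrite component_ofP.
    by have := mem_porbit (succ D) 1 ((succ D ^+ i)%g v); rewrite expg1.
  pose c' (e : edge D') := match e with inl v => c (inl (F v)) | inr k => q k end.
  exists c'; last by split=> // [k v|k k0] => [/(qP k).1|/(qP k).2].
  move=> x; have E v : ends c' v = ends c (F v).
    rewrite /ends /=; congr pair.
    exact/esym/(reach_colors K_virtual cc)/in_reach.
  by rewrite !E; apply/(crelF (ends c)); exact: cc.
- move=> c' cc'.
  have [v|p pP] := choice (P := fun (v : passage D) (x : X) =>
      (forall v', reach K (F v') v -> x = c' (inl v'))
      /\ (forall k, component_of v = g (val k) -> x = c' (inr k))).
    have [[v' rv]|[k vk]] := dich v.
      exists (c' (inl v')); split=> [w' rw|k vk].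
        by congr (c' (inl _)); apply/F_inj/(reach_uniq _ _ rv rw).
      by case: (free_reach _ _ _ vk rv).
    exists (c' (inr k)); split=> [v' rv|k' vk'].
      by case: (free_reach _ _ _ vk rv).
    by congr (c' (inr _)); apply/val_inj/(can_inj gK); rewrite -vk -vk'.
  have free' (k0 : free_component D) :
      [forall v, component_of v != g' (val k0)].
    apply/forallP => v; apply/eqP => vk.
    by have /forallP/(_ (F v)) := valP k0; rewrite -g_comp vk g'K eqxx.
  pose c (e : edge D) :=
    match e with inl v => p v | inr k0 => c' (inr (free (free' k0))) end.
  exists c; last first.
    split=> [v|k v vk|k k0 kk0] /=.
    - by rewrite ((pP (F v)).1 v) //; exact: reach_refl.
    - by rewrite ((pP v).2 k).
    - by congr (c' (inr _)); apply: val_inj; rewrite /= -kk0 gK.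
  move=> y; have [yK|] := boolP (y \in K).
    have E b : (ends c (y, b)).1 = (ends c (y, b)).2.
      rewrite /= ; have [[v' rv]|[k vk]] := dich ((succ D)^-1%g (y, b)).
        rewrite ((pP _).1 _ rv); apply/esym/(pP _).1.
        rewrite -[(y, b)](permKV (succ D)); apply: reach_succ => //.
        by rewrite permKV.
      rewrite ((pP _).2 _ vk); apply/esym/(pP _).2; rewrite -vk.
      apply/eqP; rewrite eq_sym component_ofP.
      have := mem_porbit (succ D) 1 ((succ D)^-1%g (y, b)).
      by rewrite expg1 permKV.
    by rewrite /crossing_colors K_virtual //; split; exact: E.
  rewrite fK => /codomP[x ->]; apply/(crelF (ends c)).
  have E v : ends c (F v) = ends c' v.
    rewrite /ends /=; congr pair; apply: (pP _).1; first exact: in_reach.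
    exact: reach_refl.
  by rewrite !E; exact: cc'.
- move=> c c1 c2 _ _ _ [Z1 Z2 Z3] [Z1' Z2' Z3']; apply/funext => -[v|k].
    by rewrite Z1 Z1'.
  have [kP|] := boolP [forall v, component_of v != g (val k)].
    have e : g (val k) = val (free kP) by [].
    by rewrite (Z3 _ _ e) (Z3' _ _ e).
  rewrite negb_forall => /existsP[v]; rewrite negbK => /eqP vk.
  by rewrite (Z2 _ _ vk) (Z2' _ _ vk).
- move=> c' c1 c2 _ cc1 cc2 [Z1 Z2 Z3] [Z1' Z2' Z3']; apply/funext => -[v|k0].
    have [[v' rv]|[k vk]] := dich v; last by rewrite -(Z2 _ _ vk) -(Z2' _ _ vk).
    rewrite (reach_colors K_virtual cc1 rv) (reach_colors K_virtual cc2 rv).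
    by rewrite -Z1 -Z1'.
  have kP : [forall v, component_of v != g' (val k0)].
    apply/forallP => v; apply/eqP => vk.
    by have /forallP/(_ (F v)) := valP k0; rewrite -g_comp vk g'K eqxx.
  have e : g (val (free kP)) = val k0.
    by rewrite /= g'K.
  by rewrite -(Z3 _ _ e) -(Z3' _ _ e).
- move=> phi c c' [Z1 Z2 Z3]; split=> [v|k v vk|k k0 kk0] /=.
  + by rewrite Z1.
  + by rewrite (Z2 _ _ vk).
  + by rewrite (Z3 _ _ kk0).
Qed.

End Erase.

(** * Local changes of a diagram *)

Section Recolor.
Variables (X : Type) (D : code) (I : {set passage D}).

Definition recolor (c : edge D -> X) (y : passage D -> X) : edge D -> X :=
  fun e => match e with
    | inl v => if v \in I then y v else c (inl v)
    | inr k => c (inr k)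
  end.

Definition recolorable (L L' : (edge D -> X) -> Prop) : Prop :=
  forall c, L c -> exists y, L' (recolor c y).

Definition rigid (L : (edge D -> X) -> Prop) : Prop :=
  forall c y, L c -> L (recolor c y) -> {in I, forall v, y v = c (inl v)}.

Lemma rigid_uniq L c c' : rigid L -> L c -> L c' ->
    (forall v, v \notin I -> c' (inl v) = c (inl v)) ->
    (forall k, c' (inr k) = c (inr k)) ->
  c' = c.
Proof.
move=> rL Lc Lc' cc' cck.
have c'E : c' = recolor c (fun v => c' (inl v)).
  by apply/funext => -[v|k] //=; case: ifPn => // /cc'.
apply/funext => -[v|k] //; have [vI|/cc' //] := boolP (v \in I).
by apply: (rL c (fun v => c' (inl v))) => //; rewrite -c'E.
Qed.

End Recolor.

Section LocalChange.
Variables (X : finMCBiquandleType) (S : set (X -> X)) (D : code).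
Hypothesis S_End : S `<=` End X.
Variables (vi : pred (crossing D)) (s : {perm passage D}).
Hypothesis sP : forall u v, (component_of u == component_of v) = (v \in porbit s u).

Definition recode : code := Code vi (@positive D) sP.

(* Only the edges that leave the passages in I, all of them between crossings in K, change
   colour.  The passage tau v plays in recode the part that v plays in D. *)
Variables (tau : {perm passage D}) (K : {set crossing D}) (I : {set passage D}).
Hypothesis s_tau : forall v, s (tau v) = tau (succ D v).
Hypothesis tau_K : forall v, v.1 \notin K -> tau v = v.
Hypothesis vi_K : forall x, x \notin K -> vi x = virtual x.
Hypothesis I_K : forall v, v \in I -> (v.1 \in K) && ((succ D v).1 \in K).

Definition old_colors (c : edge D -> X) : Prop := forall x, x \in K ->
  crossing_colors (virtual x) (positive x) (type_of x)
    (ends c (x, true)) (ends c (x, false)).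

Definition new_colors (c : edge D -> X) : Prop := forall x, x \in K ->
  crossing_colors (vi x) (positive x) (type_of x)
    (ends c (tau^-1%g (x, true))) (ends c (tau^-1%g (x, false))).

Hypothesis old_new : recolorable I old_colors new_colors.
Hypothesis new_old : recolorable I new_colors old_colors.
Hypothesis old_rigid : rigid I old_colors.
Hypothesis new_rigid : rigid I new_colors.

Definition pull (d : edge recode -> X) : edge D -> X :=
  fun e => match e with inl v => d (inl (tau v)) | inr k => d (inr k) end.

Definition push (c : edge D -> X) : edge recode -> X :=
  fun e => match e with inl v => c (inl (tau^-1%g v)) | inr k => c (inr k) end.

Lemma pushK c : pull (push c) = c.
Proof. by apply/funext => -[v|k] //=; rewrite permK. Qed.

Lemma pullK (d : edge recode -> X) : push (pull d) = d.
Proof. by apply/funext => -[v|k] //=; rewrite permKV. Qed.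

Lemma ends_pull (d : edge recode -> X) v : ends d v = ends (pull d) (tau^-1%g v).
Proof.
rewrite /ends /= permKV; congr (d (inl _), _).
by apply: (@perm_inj _ s); rewrite permKV s_tau !permKV.
Qed.

Lemma ends_recolor (c : edge D -> X) y v :
  v.1 \notin K -> ends (recolor I c y) v = ends c v.
Proof.
move=> vK; rewrite /ends /=.
have -> : (v \in I) = false.
  by apply: contraNF vK => /I_K/andP[].
have -> // : ((succ D)^-1%g v \in I) = false.
by apply: contraNF vK => /I_K/andP[_]; rewrite permKV.
Qed.

Lemma colors_recode (d : edge recode -> X) : colors d <->
  new_colors (pull d) /\ forall x, x \notin K ->
    crossing_colors (virtual x) (positive x) (type_of x)
      (ends (pull d) (x, true)) (ends (pull d) (x, false)).
Proof.
have tauV v : v.1 \notin K -> tau^-1%g v = v.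
  by move=> vK; apply: (@perm_inj _ tau); rewrite permKV tau_K.
split=> [dd|[d1 d2] x].
  split=> x xK; have := dd x; rewrite !ends_pull //=.
  by rewrite vi_K // !tauV.
rewrite !ends_pull; have [/d1 //|xK] := boolP (x \in K).
by have := d2 x xK; rewrite /= vi_K // !tauV.
Qed.

(** Two colourings match when they agree off [I] up to [tau]. No edge at a crossing outside [K]
    leaves a passage of [I], so only the relations at [K] are at stake: recolorability gives
    partners, rigidity their uniqueness. *)
Lemma same_polynomial_recode : same_polynomial S D recode.
Proof.
pose Z (c : edge D -> X) (d : edge recode -> X) :=
  (forall v, v \notin I -> pull d (inl v) = c (inl v))
  /\ forall k, pull d (inr k) = c (inr k).
have recolorE (c : edge D -> X) y :
    (forall v, v \notin I -> recolor I c y (inl v) = c (inl v))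
    /\ (forall k, recolor I c y (inr k) = c (inr k)).
  by split=> //= v /negPf ->.
apply: (same_polynomial_transfer S_End (Z := Z)).
- move=> c cc; have [|y yP] := @old_new c; first by move=> x _; exact: cc.
  exists (push (recolor I c y)); last by rewrite /Z pushK.
  apply/colors_recode; rewrite pushK; split=> // x xK.
  by rewrite !ends_recolor.
- move=> d /colors_recode[d1 d2]; have [y yP] := new_old d1.
  exists (recolor I (pull d) y); last first.
    by have [e1 e2] := recolorE (pull d) y; split=> [v /e1|k].
  move=> x; have [/yP //|xK] := boolP (x \in K).
  by rewrite !ends_recolor //; exact: d2.
- move=> c d1 d2 _ /colors_recode[d1c _] /colors_recode[d2c _] [Z1 Z2] [Z3 Z4].
  rewrite -(pullK d1) -(pullK d2); congr push.
  apply: (rigid_uniq new_rigid) => // [v vI|k]; first by rewrite Z1 ?Z3.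
  by rewrite Z2 Z4.
- move=> d c1 c2 _ cc1 cc2 [Z1 Z2] [Z3 Z4].
  apply: (rigid_uniq old_rigid) => [x _|x _|v vI|k].
  + exact: cc2.
  + exact: cc1.
  + by rewrite -Z1 ?Z3.
  + by rewrite -Z2 Z4.
- by move=> phi c d [Z1 Z2]; split=> [v /Z1|k] /=; [move=> <-|rewrite -Z2].
Qed.

End LocalChange.

Section Strand.
Variables (X : Type) (D : code).
Implicit Types (c : edge D -> X) (v w : passage D).

Definition strand c v w : X * X * X := (c (edge_in v), c (inl v), c (inl w)).

Lemma strand_recolor (I : {set passage D}) c y v w :
    succ D v = w -> {in I, forall u, succ D u \notin I} -> v \in I ->
  strand (recolor I c y) v w = ((strand c v w).1.1, y v, (strand c v w).2).
Proof.
move=> <- dI vI; rewrite /strand /= vI (negPf (dI v vI)).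
(* The incoming edge leaves the predecessor of [v], which cannot be in [I] because its successor [v]
   is. *)
case: ifPn => // /dI; by rewrite permKV vI.
Qed.

End Strand.

Lemma arc_strand (X : mcBiquandleType) (D : code) (c : edge D -> X) b v w :
  succ D v = w -> arc b (strand c v w) = ends c (if b then v else w).
Proof. by case: b => // <-; rewrite /ends /edge_in permK. Qed.

(** * Invariance under the moves *)

Section Moves.
Variables (X : finMCBiquandleType) (S : set (X -> X)) (D : code).
Hypothesis S_End : S `<=` End X.

Lemma component_of_succ (v : passage D) : component_of (succ D v) = component_of v.
Proof.
apply/eqP; rewrite eq_sym component_ofP.
by have := mem_porbit (succ D) 1 v; rewrite expg1.
Qed.

Definition virtualize (K : {set crossing D}) : code :=
  recode (fun x => (x \in K) || virtual x) (@component_ofP D).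

(** Making the crossings in [K] virtual changes nothing at those that survive in [D'], so [D'] also
    arises from [virtualize K] by erasing [K]. *)
Lemma same_polynomial_erases K D' : erases K D' ->
    same_polynomial S D (virtualize K) ->
  same_polynomial S D D'.
Proof.
move=> er e; suff: same_polynomial S (virtualize K) D' by exact: etrans e.
apply: (same_polynomial_presents (D := virtualize K) (K := K)
  (nx := @succ_outside D K) S_End).
- by move=> x /= ->.
- move=> v /succ_outside_reach[u ru uE]; exists u; last exact: uE.
  elim: ru => [|w _ rw wK]; first exact: reach_refl.
  exact: (@reach_succ (virtualize K)).
case: er => f [sw [g [fK gB fc gc fs]]]; exists f, sw, g.
split; [exact: fK|exact: gB| |exact: gc|exact: fs].
move=> x; have [vx px swx] := fc x; split; [|exact: px|exact: swx].
by rewrite vx /=; have := codom_f f x; rewrite -fK.2 => /negPf ->.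
Qed.

Definition virtualized_colors (K : {set crossing D}) : (edge D -> X) -> Prop :=
  new_colors (fun x => (x \in K) || virtual x) 1%g K.

Lemma virtualized_colorsE (K : {set crossing D}) k : virtualized_colors K k <->
  forall x b, x \in K -> (ends k (x, b)).1 = (ends k (x, b)).2.
Proof.
rewrite /virtualized_colors /new_colors; split=> [H x b xK|H x xK].
  by have := H x xK; rewrite invg1 !perm1 xK => -[e1 e2]; case: b.
by rewrite invg1 !perm1 xK; split; exact: H.
Qed.

Lemma same_polynomial_kink c b : succ D (c, b) = (c, ~~ b) -> ~~ virtual c ->
  same_polynomial S D (virtualize [set c]%SET).
Proof.
move=> cb vc; pose st (k : edge D -> X) := strand k (c, b) (c, ~~ b).
(* The two passages of a kink are consecutive, hence on one component. *)
have typec : type_of c = Single.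
  have := component_of_succ (c, b); rewrite cb /type_of.
  by case: (b) => /= ->; rewrite eqxx.
have stE k : arc true (st k) = ends k (c, b) /\ arc false (st k) = ends k (c, ~~ b).
  by split; rewrite /st arc_strand.
have oldE k : old_colors [set c]%SET k <-> kink_colors (positive c) b (st k).
  rewrite /kink_colors !arc_strand //; split=> [/(_ c (set11 c))|H x /set1P ->].
    by rewrite typec (negPf vc); case: (b).
  by move: H; rewrite typec (negPf vc); case: (b).
have newE k : virtualized_colors [set c]%SET k <->
    (st k).1.1 = (st k).1.2 /\ (st k).1.2 = (st k).2.
  have [eT eF] := stE k.
  rewrite virtualized_colorsE -/((arc true (st k)).1 = (arc true (st k)).2).
  rewrite -/((arc false (st k)).1 = (arc false (st k)).2) eT eF.
  split=> [e|[e1 e2] x d /set1P ->]; first by split; apply: e; rewrite set11.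
  have [->|/eqP] := eqVneq d b; first by [].
  by rewrite -[d]negbK; case: (b) (~~ d) e1 e2 => [] [].
have stR k y : st (recolor [set (c, b)]%SET k y) = ((st k).1.1, y (c, b), (st k).2).
  apply: strand_recolor; rewrite ?set11 // => v /set1P ->.
  by rewrite cb inE xpair_eqE eqxx; case: (b).
apply: (same_polynomial_recode S_End _ (tau := 1%g) (K := [set c]%SET)
  (I := [set (c, b)]%SET)).
- by move=> v; rewrite !perm1.
- by move=> v _; rewrite perm1.
- by move=> x /negPf ->.
- by move=> v /set1P ->; rewrite cb !inE !eqxx.
- move=> k /oldE/kink_through e; exists (fun=> (st k).2).
  by apply/newE; rewrite stR.
- move=> k /newE[e1 e2]; have [y yP] := kink_ex (positive c) b (st k).2.
  by exists (fun=> y); apply/oldE; rewrite stR e1 e2.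
- move=> k y /oldE H /oldE; rewrite stR => H' v /set1P ->.
  have e := kink_through H; move: H H'; rewrite -e => H H'.
  by apply/esym; apply: kink_uniq H'; move: H; rewrite {2}e -[st k]/(_, _, _).
- move=> k y /newE[e1 e2] /newE; rewrite stR /= => -[_ e] v /set1P ->.
  by rewrite e; exact: esym.
Qed.

Lemma same_polynomial_bigon c d t : succ D (c, true) = (d, true) ->
    neighbours t (c, false) (d, false) -> positive c = ~~ positive d ->
    ~~ virtual c -> ~~ virtual d ->
  same_polynomial S D (virtualize [set c; d]%SET).
Proof.
move=> cd cdt pcd /negPf vc /negPf vd.
have ncd : c == d = false.
  by apply/eqP => e; move: pcd; rewrite e; case: (positive d).
have ndc : d == c = false by rewrite eq_sym.
pose v := (c, true); pose u := if t then (c, false) else (d, false).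
pose u' := if t then (d, false) else (c, false).
have uu' : succ D u = u' by move: cdt; rewrite /u /u'; case: (t).
(* Both strands run through both crossings, so the same components meet at [c] and [d]. *)
have typ : type_of d = type_of c.
  rewrite /type_of -cd component_of_succ; congr (if _ == _ then _ else _).
  move: cdt; rewrite /neighbours; case: (t) => <-; by rewrite component_of_succ.
pose o k := strand k v (d, true) : X * X * X; pose w k := strand k u u' : X * X * X.
pose K := [set c; d]%SET; pose I := [set v; u]%SET.
have oldE k : old_colors K k <-> bigon_colors (type_of c) (positive c) t (o k) (w k).
  rewrite /bigon_colors !arc_strand //; split=> [H|[H1 H2] x /set2P[] ->].
  - have := H c (set21 _ _); have := H d (set22 _ _).
    by rewrite typ vc vd /u /u' pcd negbK; case: (t).
  - by move: H1; rewrite vc /u /u'; case: (t).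
  - by move: H2; rewrite typ vd pcd negbK /u /u'; case: (t).
have newE k : virtualized_colors K k <->
    ((o k).1.1 = (o k).1.2 /\ (o k).1.2 = (o k).2)
    /\ ((w k).1.1 = (w k).1.2 /\ (w k).1.2 = (w k).2).
  rewrite virtualized_colorsE.
  rewrite -/((arc true (o k)).1 = (arc true (o k)).2).
  rewrite -/((arc false (o k)).1 = (arc false (o k)).2).
  rewrite -/((arc true (w k)).1 = (arc true (w k)).2).
  rewrite -/((arc false (w k)).1 = (arc false (w k)).2) !arc_strand //.
  split=> [e|[[e1 e2] [e3 e4]] x b].
    have [cK dK] : c \in K /\ d \in K by rewrite !inE !eqxx orbT.
    by rewrite /u /u'; case: (t); do ?split; apply: e.
  move: e3 e4; rewrite /u /u' => e3 e4.
  by case/set2P=> ->; case: b => //; move: e3 e4; case: (t).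
have dI : {in I, forall x, succ D x \notin I}.
  by move=> x /set2P[] ->; rewrite ?[succ D v]cd ?uu' !inE /v /u /u'; case: (t);
    rewrite !xpair_eqE ?ncd ?ndc ?andbF.
have oR k y : o (recolor I k y) = ((o k).1.1, y v, (o k).2).
  by apply: strand_recolor; rewrite // set21.
have wR k y : w (recolor I k y) = ((w k).1.1, y u, (w k).2).
  by apply: strand_recolor; rewrite // set22.
have vu : v == u = false by rewrite /v /u; case: (t); rewrite xpair_eqE andbF.
apply: (same_polynomial_recode S_End _ (tau := 1%g) (K := K) (I := I)).
- by move=> x; rewrite !perm1.
- by move=> x _; rewrite perm1.
- by move=> x /negPf ->.
- move=> x /set2P[] ->; rewrite ?cd ?uu' /u /u' !inE ?eqxx ?orbT //.
  by case: (t); rewrite !eqxx ?orbT.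
- move=> k /oldE/bigon_through[e1 e2].
  exists (fun x => if x == v then (o k).2 else (w k).2).
  by apply/newE; rewrite oR wR eqxx eq_sym vu.
- move=> k /newE[[e1 e2] [e3 e4]].
  have [y [y' yP]] := bigon_ex (type_of c) (positive c) t (o k).2 (w k).2.
  exists (fun x => if x == v then y else y').
  by apply/oldE; rewrite oR wR eqxx eq_sym vu e1 e2 e3 e4.
- move=> k y /oldE H /oldE; rewrite oR wR => H'.
  have [e1 e2] := bigon_through H; rewrite e1 e2 in H'.
  have [||] := @bigon_uniq _ (type_of c) (positive c) t (o k).2 (w k).2
    (y v) (y u) (o k).1.2 (w k).1.2 => //.
    by move: H; rewrite [o k]surjective_pairing [(o k).1]surjective_pairing e1
      [w k]surjective_pairing [(w k).1]surjective_pairing e2.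
  by move=> e3 e4 x /set2P[] ->.
- move=> k y /newE[[e1 e2] [e3 e4]] /newE; rewrite oR wR /=.
  by move=> -[[_ e5] [_ e6]] x /set2P[] ->; rewrite ?e5 ?e6; exact: esym.
Qed.

End Moves.

Lemma same_polynomial_isotopy (X : finMCBiquandleType) (S : set (X -> X))
    (S_End : S `<=` End X) (D D' : code) :
  presents finset.set0 (succ D) D' -> same_polynomial S D D'.
Proof.
apply: same_polynomial_presents => // [x|v _]; first by rewrite inE.
by exists v => //; exact: reach_refl.
Qed.

(** * Sliding a strand across a crossing *)

Section Slide.
Variables (X : finMCBiquandleType) (S : set (X -> X)) (D : code).
Hypothesis S_End : S `<=` End X.

(** The renaming [F] conjugates [succ D'] to [s], so the components of [D] are the orbits of the
    rewired passages too, as [recode] requires. *)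
Lemma presents_porbit (s : {perm passage D}) D' : presents finset.set0 s D' ->
  forall u v : passage D, (component_of u == component_of v) = (v \in porbit s u).
Proof.
move=> [f [sw [g /= [[f_inj fK] [g' gK _] _ gF sF]]]].
pose F (v : passage D') : passage D := (f v.1, v.2 (+) sw v.1).
have {}gF v : g (component_of v) = component_of (F v) := gF v.
have {}sF v : F (succ D' v) = s (F v) := sF v.
have F_onto v : exists v', v = F v'.
  have /codomP[x vx] : v.1 \in codom f by rewrite -fK inE.
  exists (x, v.2 (+) sw x).
  by rewrite /F /= -addbA addbb addbF -vx -surjective_pairing.
have F_inj : injective F.
  by move=> [x b] [y b'] [/f_inj <-] /= /addIb <-.
have FX i v : F ((succ D' ^+ i)%g v) = (s ^+ i)%g (F v).
  by elim: i => [|i IHi]; rewrite ?expg0 ?perm1 // !expgSr !permM sF IHi.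
move=> u v; have [u' ->] := F_onto u; have [v' ->] := F_onto v.
rewrite -!gF (inj_eq (can_inj gK)) component_ofP.
apply/porbitP/porbitP => -[i e]; exists i; first by rewrite e FX.
by apply: F_inj; rewrite e FX.
Qed.

(** [tau] exchanges the two passages of each strand through the triangle, which negates [t], [m] and
    [n]. The three inner edges are recoloured by [triangle_colors_flip], in a unique way by
    [triangle_colors_uniq]. *)
Lemma same_polynomial_triangle (a b c : crossing D) (t m n : bool)
    (tau := (tperm (a, true) (b, true) * tperm (a, false) (c, true)
             * tperm (b, false) (c, false))%g) sP :
    uniq [:: a; b; c] ->
    virtual a = virtual b -> (virtual c -> virtual a) ->
    neighbours t (a, true) (b, true) ->
    neighbours m (a, false) (c, true) ->
    neighbours n (b, false) (c, false) ->
    positive a (+) t (+) m = positive b (+) t (+) n ->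
    positive b (+) t (+) n = positive c (+) m (+) n ->
  same_polynomial S D (@recode D (@virtual D) (succ D ^ tau)%g sP).
Proof.
rewrite /= !inE negb_or => /andP[/andP[nab nac] /andP[nbc _]] vab vca ht hm hn ps1 ps2.
have [[ab ba] [ac ca] [bc cb]] : [/\ (a == b) = false /\ (b == a) = false,
    (a == c) = false /\ (c == a) = false & (b == c) = false /\ (c == b) = false].
  by rewrite (eq_sym b a) (eq_sym c a) (eq_sym c b) !(negPf nab, negPf nac, negPf nbc).
pose neq := (ab, ba, ac, ca, bc, cb).
have [tau1 tau2 tau3] : [/\ tau (a, true) = (b, true),
    tau (a, false) = (c, true) & tau (b, false) = (c, false)].
  by split; rewrite /tau !permM !permE /=; do 3![rewrite ?xpair_eqE ?eqxx ?neq /=].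
have [tau4 tau5 tau6] : [/\ tau (b, true) = (a, true),
    tau (c, true) = (a, false) & tau (c, false) = (b, false)].
  by split; rewrite /tau !permM !permE /=; do 3![rewrite ?xpair_eqE ?eqxx ?neq /=].
have tauV u v : tau u = v -> tau^-1%g v = u by move=> <-; rewrite permK.
pose ta := if t then (a, true) else (b, true).
pose tb := if t then (b, true) else (a, true).
pose ma := if m then (a, false) else (c, true).
pose mc := if m then (c, true) else (a, false).
pose nb := if n then (b, false) else (c, false).
pose nc := if n then (c, false) else (b, false).
have st : succ D ta = tb by rewrite /ta /tb; case: (t) ht.
have sm : succ D ma = mc by rewrite /ma /mc; case: (m) hm.
have sn : succ D nb = nc by rewrite /nb /nc; case: (n) hn.
pose T k := strand k ta tb : X * X * X.
pose M k := strand k ma mc : X * X * X.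
pose N k := strand k nb nc : X * X * X.
pose K := [set a; b; c]%SET; pose I := [set ta; ma; nb]%SET.
have KP x : x \in K -> [\/ x = a, x = b | x = c].
  by rewrite !inE -orbA => /or3P[] /eqP ->; [apply: Or31|apply: Or32|apply: Or33].
have IP v : v \in I -> [\/ v = ta, v = ma | v = nb].
  by rewrite !inE -orbA => /or3P[] /eqP ->; [apply: Or31|apply: Or32|apply: Or33].
have [aK bK cK] : [/\ a \in K, b \in K & c \in K] by rewrite !inE !eqxx ?orbT.
have [tI mI nI] : [/\ ta \in I, ma \in I & nb \in I] by rewrite !inE !eqxx ?orbT.
have dI : {in I, forall v, succ D v \notin I}.
  by move=> v /IP[] ->; rewrite ?st ?sm ?sn !inE /ta /tb /ma /mc /nb /nc;
    case: (t) (m) (n) => [] [] []; rewrite ?xpair_eqE ?neq ?andbF ?eqxx.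
have [tm [tn mn]] : ta != ma /\ ta != nb /\ ma != nb.
  rewrite /ta /ma /nb; case: (t) (m) (n) => [] [] [];
  by rewrite ?xpair_eqE ?neq ?eqxx ?andbF.
(* Being on the same component is transitive, so the number of single-component crossings among the
   three is never two; the five patterns left are the admissible triples. *)
have adm : admissible (type_of c) (type_of b) (type_of a).
  have et : component_of (a, true) = component_of (b, true).
    by move: ht; rewrite /neighbours; case: (t) => <-; rewrite component_of_succ.
  have em : component_of (a, false) = component_of (c, true).
    by move: hm; rewrite /neighbours; case: (m) => <-; rewrite component_of_succ.
  have en : component_of (b, false) = component_of (c, false).
    by move: hn; rewrite /neighbours; case: (n) => <-; rewrite component_of_succ.
  rewrite /type_of et em en.
  have [->|] := eqVneq (component_of (b, true)) (component_of (c, true)).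
    by case: ifP.
  case: ifP => [/eqP <-|] /=; first by rewrite eq_sym => /negPf ->.
  by case: ifP.
pose L t m n := @triangle_colors X (virtual a) (virtual c) (positive a) (positive b)
  (positive c) t m n (type_of a) (type_of b) (type_of c).
have oldE k : old_colors K k <-> L t m n (T k) (M k) (N k).
  rewrite /L /triangle_colors !arc_strand //; split=> [H|[H1 H2 H3] x /KP[] ->].
  - have := H c cK; have := H b bK; have := H a aK; rewrite -vab.
    by rewrite /ta /tb /ma /mc /nb /nc; case: (t) (m) (n) => [] [] [].
  - by move: H1; rewrite /ta /tb /ma /mc; case: (t) (m) => [] [].
  - by move: H2; rewrite -vab /ta /tb /nb /nc; case: (t) (n) => [] [].
  - by move: H3; rewrite /ma /mc /nb /nc; case: (m) (n) => [] [].
pose new := @new_colors X D (@virtual D) tau K.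
have newE k : new k <-> L (~~ t) (~~ m) (~~ n) (T k) (M k) (N k).
  rewrite /L /triangle_colors !arc_strand //; split=> [H|[H1 H2 H3] x /KP[] ->].
  - have := H c cK; have := H b bK; have := H a aK; rewrite -vab.
    rewrite (tauV _ _ tau1) (tauV _ _ tau2) (tauV _ _ tau3).
    rewrite (tauV _ _ tau4) (tauV _ _ tau5) (tauV _ _ tau6).
    by rewrite /ta /tb /ma /mc /nb /nc; case: (t) (m) (n) => [] [] [].
  - rewrite (tauV _ _ tau4) (tauV _ _ tau5).
    by move: H1; rewrite /ta /tb /ma /mc; case: (t) (m) => [] [].
  - rewrite (tauV _ _ tau1) (tauV _ _ tau6).
    by move: H2; rewrite -vab /ta /tb /nb /nc; case: (t) (n) => [] [].
  - rewrite (tauV _ _ tau2) (tauV _ _ tau3).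
    by move: H3; rewrite /ma /mc /nb /nc; case: (m) (n) => [] [].
have TR k y : T (recolor I k y) = ((T k).1.1, y ta, (T k).2).
  exact: strand_recolor st dI tI.
have MR k y : M (recolor I k y) = ((M k).1.1, y ma, (M k).2).
  exact: strand_recolor sm dI mI.
have NR k y : N (recolor I k y) = ((N k).1.1, y nb, (N k).2).
  exact: strand_recolor sn dI nI.
pose choose x y z (v : passage D) : X :=
  if v == ta then x else if v == ma then y else z.
have chooseE x y z : [/\ choose x y z ta = x, choose x y z ma = y & choose x y z nb = z].
  rewrite /choose !eqxx ![ma == _]eq_sym ![nb == _]eq_sym.
  by rewrite (negPf tm) (negPf tn) (negPf mn).
(* The sign equations survive the negation of [t], [m] and [n], so the flip also leads back from the
   new triangle. *)
have sgnN (p q r s u w : bool) : p (+) q (+) r = s (+) u (+) w ->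
    p (+) ~~ q (+) ~~ r = s (+) ~~ u (+) ~~ w.
  by move: p q r s u w => [] [] [] [] [] [].
have Lrec t' m' n' k : positive a (+) t' (+) m' = positive b (+) t' (+) n' ->
    positive b (+) t' (+) n' = positive c (+) m' (+) n' ->
    L t' m' n' (T k) (M k) (N k) ->
    exists y, L (~~ t') (~~ m') (~~ n')
      (T (recolor I k y)) (M (recolor I k y)) (N (recolor I k y)).
  move=> p1 p2 /(triangle_colors_flip vca adm p1 p2)[x [y [z H]]].
  exists (choose x y z); rewrite TR MR NR.
  by have [-> -> ->] := chooseE x y z.
have Lrig t' m' n' k y : positive a (+) t' (+) m' = positive b (+) t' (+) n' ->
    positive b (+) t' (+) n' = positive c (+) m' (+) n' ->
    L t' m' n' (T k) (M k) (N k) ->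
    L t' m' n' (T (recolor I k y)) (M (recolor I k y)) (N (recolor I k y)) ->
    {in I, forall v, y v = k (inl v)}.
  rewrite TR MR NR => p1 p2 H1 H2.
  have [e1 e2 e3] := triangle_colors_uniq (T := ((T k).1.1, (T k).2))
    (M := ((M k).1.1, (M k).2)) (N := ((N k).1.1, (N k).2)) p1 p2 vca H2 H1.
  by move=> v /IP[] ->.
apply: (same_polynomial_recode S_End _ (tau := tau) (K := K) (I := I)) => //.
- by move=> v; rewrite permJ.
- move=> [x e]; rewrite !inE !negb_or => /andP[/andP[/negPf xa /negPf xb] /negPf xc].
  by rewrite /tau !permM !tpermD // xpair_eqE eq_sym ?xa ?xb ?xc.
- move=> v /IP[] ->; rewrite ?st ?sm ?sn /ta /tb /ma /mc /nb /nc.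
  + by case: (t); rewrite aK bK.
  + by case: (m); rewrite aK cK.
  + by case: (n); rewrite bK cK.
- by move=> k /oldE/(Lrec _ _ _ _ ps1 ps2)[y yP]; exists y; apply/newE.
- move=> k /newE/(Lrec _ _ _ _ (sgnN _ _ _ _ _ _ ps1) (sgnN _ _ _ _ _ _ ps2))[y].
  by rewrite !negbK => yP; exists y; apply/oldE.
- by move=> k y /oldE H1 /oldE H2; exact: Lrig ps1 ps2 H1 H2.
- move=> k y /newE H1 /newE H2.
  by apply: (Lrig _ _ _ k y _ _ H1 H2); apply: sgnN.
Qed.

Lemma same_polynomial_move D' : move D D' -> same_polynomial S D D'.
Proof.
case.
- exact: same_polynomial_isotopy S_End _ _.
- move=> c b cb er; have [vc|vc] := boolP (virtual c).
    apply: same_polynomial_presents er => // [x /set1P -> //|v].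
    exact: succ_outside_reach.
  exact: (same_polynomial_erases S_End er (same_polynomial_kink S_End cb vc)).
- move=> c d t vcd pcd cd cdt er; have [vc|vc] := boolP (virtual c).
    apply: same_polynomial_presents er => // [x /set2P[] -> //|v].
      by rewrite -vcd.
    exact: succ_outside_reach.
  have vd : ~~ virtual d by rewrite -vcd.
  exact: (same_polynomial_erases S_End er
    (same_polynomial_bigon S_End cd cdt pcd vc vd)).
- move=> a b c t m n abc [vab vca] ht hm hn p1 p2 pr.
  have e := same_polynomial_triangle (presents_porbit pr) abc vab vca ht hm hn p1 p2.
  exact: etrans e (same_polynomial_isotopy S_End
    (D := recode _ (presents_porbit pr)) pr).
Qed.

End Slide.

Theorem theorem4 (D D' : diagram) (X : finMCBiquandleType) (S : set (X -> X))
    (DD' : same_link D D') (S_End : S `<=` End X) :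
  in_degree_polynomial (coloring_quiver D X S)
  = in_degree_polynomial (coloring_quiver D' X S).
Proof.
elim: DD' => {D D'} [D D' DD'|//|D D' _ ->|D D' D'' _ -> _ ->] //.
exact: (same_polynomial_move S_End DD').
Qed.
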